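(* Let $\phi$ and $B$ satisfy the slowly varying moment class assumption stated in the context. Fix $\beta\in(0,1)$ and write $\xi_n=\log(1/\beta)/n$. Then there is a sequence of margins $\Delta_n>0$ with $$\Delta_n=m^{-1}(\xi_n)\,(1+o(1)),\qquad n\to\infty,$$ such that the fixed-margin-optimal $M$-estimator $\mu_n$ synthesized at margin $\Delta_n$ (see context) attains confidence level $\beta$ at margin $\Delta_n$ for all sufficiently large $n$: $\beta_n(\mu_n;\Delta_n)\le\beta$.
   Context: Slowly varying moment class assumption: $\phi:\mathbb R\to[0,\infty)$ is even, continuous, non-decreasing on $[0,\infty)$, $\phi(x)/|x|\to\infty$ as $|x|\to\infty$, $\phi(0)<B$, and (A1) there is $x_0>0$ with $\phi(x)=0$ for $|x|\le x_0$; (A2) with $\Lambda(x)=\phi(x)/|x|$, there exist $x_\infty>1$, $\Lambda_0>0$ and a continuously differentiable $\eta:[x_\infty,\infty)\to(0,\infty)$ such that $\Lambda(x)=\Lambda_0\exp\{\int_{x_\infty}^x\frac{\eta(u)}{u}\,du\}$ for $x\ge x_\infty$, where (i) $\eta(x)\to0$; (ii) $\int_{x_\infty}^\infty\frac{\eta(u)}{u}\,du=\infty$; (iii) $x\eta'(x)/\eta(x)\to0$ as $x\to\infty$. Then $\Lambda$ is a strictly increasing continuous bijection of $[x_\infty,\infty)$ onto $[\Lambda(x_\infty),\infty)$, with inverse $\Lambda^{-1}$. For $\Delta>0$ with $B/\Delta\ge\Lambda(x_\infty)$ set $m(\Delta)=\Delta/\Lambda^{-1}(B/\Delta)$; $m$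 is continuous, strictly increasing, and $m(\Delta)\to0$ as $\Delta\downarrow0$, so $m^{-1}$ is defined on a right neighborhood of $0$. For $\mu\in\mathbb R$, $\mathcal C_\mu$ is the set of Borel probability measures $P$ on $\mathbb R$ with $\int x\,dP=\mu$ and $\int\phi(x-\mu)\,dP\le B$. The worst-case confidence level of a measurable estimator $\mu_n=\mu_n(X_1,\dots,X_n)$ is $$\beta_n(\mu_n;\Delta)=\max\Bigl\{\sup_{\mu\in\mathbb R,\,P_\mu\in\mathcal C_\mu}P_\mu[\mu_n>\mu+\Delta],\ \sup_{\mu\in\mathbb R,\,P_\mu\in\mathcal C_\mu}P_\mu[\mu_n<\mu-\Delta]\Bigr\},$$ with $X_1,\dots,X_n$ i.i.d. of law $P_\mu$ under $P_\mu$. Synthesized estimator at margin $\Delta$: for $\lambda=(\lambda_1,\lambda_2)\in\mathbb R\times[0,\infty)$ put $g_u^\lambda(x)=1+\lambda_1x+\lambda_2(\phi(x)-B)$, $g_l^\lambda(x)=1-\lambda_1x+\lambda_2(\phi(x)-B)$; $C$ is the set of such $\lambda$ with $g_u^\lambda>0$ and $g_l^\lambda>0$ on $\mathbb R$; for $\lambda\in C$, $\psi_u^\lambda(x)=\log g_u^\lambda(x+\Delta)$, $\psi_l^\lambda(x)=-\log g_l^\lambda(x-\Delta)$. $r_M'(\Delta)$ is the supremum of all $r\in\mathbb R$ for which there are $\lambda\in C$ and a non-decreasing $\psi:\mathbb R\to\mathbb R$ with $\psi_l^\lambda+r\le\psi\le\psi_u^\lambda-r$ on $\mathbb R$. This supremum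 is attained at some $\lambda^\star\in C$; pick any non-decreasing $\psi$ with $\psi_l^{\lambda^\star}+r_M'(\Delta)\le\psi\le\psi_u^{\lambda^\star}-r_M'(\Delta)$. The fixed-margin-optimal $M$-estimator at margin $\Delta$ is $\mu_n=\inf\{\theta\in\mathbb R:\sum_{i=1}^n\psi(X_i-\theta)\le0\}$ (finite and measurable when $r_M'(\Delta)>0$). *)

(* Defs.v *)
From HB Require Import structures.
From mathcomp Require Import all_boot all_order all_algebra.
From mathcomp Require Import all_classical all_reals all_analysis.

Set Implicit Arguments.
Unset Strict Implicit.
Unset Printing Implicit Defensive.

Import Order.TTheory GRing.Theory Num.Theory.
Import numFieldNormedType.Exports.

Local Open Scope classical_set_scope.
Local Open Scope ring_scope.

Section iid_law.
Context d (T : measurableType d) (R : realType).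

Definition tuple_cons n (p : T * n.-tuple T) : n.+1.-tuple T :=
  [tuple of p.1 :: p.2].

Lemma measurable_tuple_cons n : measurable_fun setT (@tuple_cons n).
Proof. exact: (measurable_cons measurable_fst measurable_snd). Qed.

HB.instance Definition _ n :=
  isMeasurableFun.Build _ _ _ _ (@tuple_cons n) (@measurable_tuple_cons n).

Variable P : probability T R.

(* The joint law of (X_1, ..., X_n) when the X_i are i.i.d. of law P, that is
   the n-fold product measure of P, built as the image of P \x P^(n-1). *)
Fixpoint iid_law n : probability (n.-tuple T) R :=
  if n is n'.+1 then distribution (P \x iid_law n')%E (@tuple_cons n')
  else dirac [tuple].

Lemma iid_law_rect n (A : 'I_n -> set T) : (forall i, measurable (A i)) ->
  iid_law n [set X | forall i, A i (tnth X i)] = (\prod_(i < n) P (A i))%E.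
Proof.
elim: n A => [|n IH] A mA /=.
  rewrite big_ord0 diracE mem_set// => i; by case: i.
rewrite big_ord_recl -IH; last by move=> i; exact: mA.
rewrite /distribution /pushforward /=.
rewrite -product_measure1E//; last first.
  rewrite [X in measurable X](_ : _ =
    \bigcap_(i in [set: 'I_n]) ((@tnth n T)^~ i @^-1` A (lift ord0 i))).
    apply: fin_bigcap_measurable => // i _.
    by rewrite -[X in measurable X]setTI; exact: measurable_tnth.
  by apply/seteqP; split => [x Ax i _|x Ax i]; exact: Ax.
congr product_measure1; apply/seteqP; split => [[x y]/= H|[x y]/= [H1 H2] i].
  split; first exact: (H ord0).
  by move=> i; have := H (lift ord0 i); rewrite tnthS.
case: (unliftP ord0 i) => [j ->|->//].
by rewrite tnthS.
Qed.

End iid_law.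

Section moment_class.
Context (R : realType).
Implicit Types (phi : R -> R) (B : R).

Definition moment_class phi B (mu : R) :
    set (probability (measurableTypeR R) R) :=
  [set P | [/\ P.-integrable [set: measurableTypeR R] (fun x : measurableTypeR R => x%:E),
               (\int[P]_x x%:E = mu%:E)%E &
               (\int[P]_x (phi (x - mu))%:E <= B%:E)%E]].

(* f has derivative df on A, in the sense relative to A (one-sided at an end
   point of an interval A), and df is continuous on A. *)
Definition C1_on (A : set R) (f df : R -> R) : Prop :=
  (forall x, A x ->
     (f y - f x) / (y - x) @[y --> within A x^'] --> df x) /\
  {within A, continuous df}.

Definition Lambda phi (x : R) : R := phi x / `|x|.

Record slowly_varying_moment_class phi B (xinf Lambda0 : R) (eta deta : R -> R)
    : Prop := {
  svm_ge0 : forall x, 0 <= phi x;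
  svm_even : forall x, phi (- x) = phi x;
  svm_continuous : continuous phi;
  svm_nondecreasing : {in `[0, +oo[ &, {homo phi : x y / x <= y}};
  svm_superlinear_pinfty : phi x / `|x| @[x --> +oo] --> +oo;
  svm_superlinear_ninfty : phi x / `|x| @[x --> -oo] --> +oo;
  svm_lt_B : phi 0 < B;
  svm_flat : exists x0 : R, 0 < x0 /\ forall x, `|x| <= x0 -> phi x = 0;
  svm_xinf_gt1 : 1 < xinf;
  svm_Lambda0_gt0 : 0 < Lambda0;
  svm_eta_gt0 : forall x, xinf <= x -> 0 < eta x;
  svm_eta_C1 : C1_on `[xinf, +oo[ eta deta;
  svm_Lambda : forall x, xinf <= x ->
    Lambda phi x = Lambda0 *
      expR (\int[lebesgue_measure]_(u in `[xinf, x]) (eta u / u));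
  svm_eta_cvg0 : eta x @[x --> +oo] --> 0;
  svm_eta_int : (\int[lebesgue_measure]_(u in `[xinf, +oo[) (eta u / u)%:E
                 = +oo)%E;
  svm_eta_slow : x * deta x / eta x @[x --> +oo] --> 0 }.

(* Inverse of Lambda as a bijection from [xinf, +oo[ onto
   [Lambda xinf, +oo[ (unspecified outside of the latter). *)
Definition Lambda_inv phi (xinf : R) : R -> R := pinv `[xinf, +oo[ (Lambda phi).

Definition margin_fun phi B (xinf Delta : R) : R :=
  Delta / Lambda_inv phi xinf (B / Delta).

Definition margin_dom phi B (xinf : R) : set R :=
  [set Delta | 0 < Delta /\ Lambda phi xinf <= B / Delta].

(* Inverse of the injective function margin_fun on margin_dom, meaningful on
   its image, a right neighborhood of 0. *)
Definition margin_inv phi B (xinf : R) : R -> R :=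
  pinv (margin_dom phi B xinf) (margin_fun phi B xinf).

(* Estimators take values in the extended reals so that the infimum defining
   an M-estimator is never truncated: an infinite value is an estimation
   error. *)
Definition worst_case_level phi B n
    (est : n.-tuple (measurableTypeR R) -> \bar R) (Delta : R) : \bar R :=
  maxe
    (ereal_sup [set p | exists mu P, moment_class phi B mu P /\
       p = iid_law P n [set X | (mu + Delta)%:E < est X]%E])
    (ereal_sup [set p | exists mu P, moment_class phi B mu P /\
       p = iid_law P n [set X | est X < (mu - Delta)%:E]%E]).

Definition g_u phi B (lam : R * R) (x : R) : R :=
  1 + lam.1 * x + lam.2 * (phi x - B).

Definition g_l phi B (lam : R * R) (x : R) : R :=
  1 - lam.1 * x + lam.2 * (phi x - B).

Definition admissible phi B : set (R * R) :=
  [set lam | 0 <= lam.2 /\ forall x, 0 < g_u phi B lam x /\ 0 < g_l phi B lam x].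

Definition psi_u phi B (Delta : R) lam (x : R) : R :=
  ln (g_u phi B lam (x + Delta)).

Definition psi_l phi B (Delta : R) lam (x : R) : R :=
  - ln (g_l phi B lam (x - Delta)).

(* psi lies between the two barriers of lam with slack r on both sides. *)
Definition separates phi B (Delta : R) (lam : R * R) (r : R) (psi : R -> R) :
    Prop :=
  {homo psi : x y / x <= y} /\
  forall x, psi_l phi B Delta lam x + r <= psi x <= psi_u phi B Delta lam x - r.

Definition opt_rate phi B (Delta : R) : \bar R :=
  ereal_sup [set r%:E | r in [set r | exists lam psi,
    admissible phi B lam /\ separates phi B Delta lam r psi]].

Definition optimal_score phi B (Delta : R) (psi : R -> R) : Prop :=
  exists lam r, [/\ admissible phi B lam, opt_rate phi B Delta = r%:E &
    separates phi B Delta lam r psi].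

Definition M_estimator (psi : R -> R) n
    (X : n.-tuple (measurableTypeR R)) : \bar R :=
  ereal_inf [set theta%:E | theta in
    [set theta : R | \sum_(i < n) psi (tnth X i - theta) <= 0]].

End moment_class.

(* Main.v *)
(* If [psi] lies between the two barriers with slack [r], then exp(psi) shifted
   by the margin is dominated by exp(-r) times the affine function [g_u] of
   (x, phi x), whose mean is at most 1 over the moment class, so that Markov's
   inequality gives the level exp(-n r).  It thus suffices to show that the
   optimal rate at margin (1 + eps) m^-1(xi) is at least xi, for small xi.

   A monotone [psi] with slack [r] exists as soon as g(s) g(t) >= exp(2 r)
   whenever s + t >= 2 Delta, where g = [g_u].  Parametrize Delta = B / Lambda X,
   so that m(Delta) = B / phi X, and let e = eta X.  The multipliers
     lam_1 = k (1 + e) / (e X),   lam_2 = k / (e X Lambda X),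
   with k < 1 close to 1, are proportional to those for which [g_u] has a double
   zero at - X (up to the term lam_2 B); they satisfy
   lam_1 Delta - lam_2 B = k m(Delta).  At s = t = Delta this is the rate
   k m(Delta) (1 + o(1)), and slow variation makes the product inequality hold
   for the other pairs as well.  Finally m(Delta) / Delta is increasing, whence
   m((1 + eps) D) >= (1 + eps) m(D), and eps absorbs the loss 1 - k. *)
Require Import Defs.
From HB Require Import structures.
From mathcomp Require Import all_boot all_order all_algebra.
From mathcomp Require Import all_classical all_reals all_analysis.
From mathcomp Require Import measurable_realfun ring lra.

Set Implicit Arguments.
Unset Strict Implicit.
Unset Printing Implicit Defensive.

Import Order.TTheory GRing.Theory Num.Theory.
Import numFieldNormedType.Exports.

Local Open Scope classical_set_scope.
Local Open Scope ring_scope.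

(** * Chernoff bound for M-estimators *)

Lemma lee_expe2r (R : realDomainType) n (x y : \bar R) :
  (0 <= x -> x <= y -> x ^+ n <= y ^+ n)%E.
Proof.
by move=> x0 xy; elim: n => // n IH; rewrite !expeS lee_pmul// expe_ge0.
Qed.

Lemma measurable_prod_tnth d (T : measurableType d) (R : realType)
    (F : T -> R) n : measurable_fun setT F ->
  measurable_fun [set: n.-tuple T] (fun X => \prod_(i < n) F (tnth X i)).
Proof.
move=> mF; apply: measurable_prod => i _.
by apply: (measurableT_comp mF); exact: measurable_tnth.
Qed.

Lemma integral_iid_law_prod d (T : measurableType d) (R : realType)
    (P : probability T R) (F : T -> R) n :
    measurable_fun setT F -> (forall x, 0 <= F x) ->
  (\int[iid_law P n]_X (\prod_(i < n) F (tnth X i))%:E =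
   (\int[P]_x (F x)%:E) ^+ n)%E.
Proof.
move=> mF F0; elim: n => [|n IH].
  rewrite integral_dirac//=; first by rewrite diracT mul1e big_ord0.
  by apply/measurable_EFinP; exact: measurable_prod_tnth.
have prod_ge0 m (X : m.-tuple T) : (0 <= (\prod_(i < m) F (tnth X i))%:E)%E.
  by rewrite lee_fin prodr_ge0.
rewrite expeS [LHS]ge0_integral_distribution//; last first.
  by apply/measurable_EFinP; exact: measurable_prod_tnth.
rewrite fubini_tonelli1//; last first.
- by move=> x /=; exact: prod_ge0.
- apply: measurableT_comp; last exact: measurable_tuple_cons.
  by apply/measurable_EFinP; exact: measurable_prod_tnth.
rewrite /fubini_F /=.
transitivity (\int[P]_x ((F x)%:E * (\int[P]_x (F x)%:E) ^+ n))%E.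
  apply: eq_integral => x _; rewrite -IH -ge0_integralZl_EFin//.
  - apply: eq_integral => X _; rewrite big_ord_recl /= -EFinM.
    by congr (_ * _)%:E; apply: eq_bigr => i _; rewrite tnthS.
  - by apply/measurable_EFinP; exact: measurable_prod_tnth.
rewrite ge0_integralZr//.
- exact/measurable_EFinP.
- by move=> x _; rewrite lee_fin.
- by rewrite expe_ge0// integral_ge0// => x _; rewrite lee_fin.
Qed.

(** Markov's inequality for the product of the [expR (f X_i)], whose mean factorizes by
    independence. *)
Lemma iid_law_chernoff d (T : measurableType d) (R : realType)
    (P : probability T R) (f : T -> R) (C : R) n : measurable_fun setT f ->
  (\int[P]_x (expR (f x))%:E <= C%:E)%E ->
  (iid_law P n [set X | (0 <= \sum_(i < n) f (tnth X i))%R] <= (C ^+ n)%:E)%E.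
Proof.
move=> mf fC.
have mF : measurable_fun setT (fun x => expR (f x)) by exact: measurableT_comp.
have -> : [set X : n.-tuple T | 0 <= \sum_(i < n) f (tnth X i)] =
    setT `&` [set X | (1%:E <= `|(\prod_(i < n) expR (f (tnth X i)))%:E|)%E].
  rewrite setTI; apply/seteqP; split => X /=;
  by rewrite lee_fin ger0_norm -?expR_sum ?expR_ge0// -[1]expR0 ler_expR.
rewrite -[leLHS]mul1e.
have mprod : measurable_fun [set: n.-tuple T]
    (fun X => (\prod_(i < n) expR (f (tnth X i)))%:E).
  by apply/measurable_EFinP; exact: measurable_prod_tnth mF.
apply: (le_trans (le_integral_abse (iid_law P n) measurableT mprod ltr01)).
rewrite (eq_integral (fun X : n.-tuple T => (\prod_(i < n) expR (f (tnth X i)))%:E));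
  last by move=> X _; rewrite gee0_abs// lee_fin prodr_ge0.
rewrite (integral_iid_law_prod P n mF) => [|x]; last exact: expR_ge0.
by rewrite EFin_expe lee_expe2r// integral_ge0// => x _; rewrite lee_fin expR_ge0.
Qed.

Section moment_bound.
Context (R : realType) (phi : R -> R) (B : R).
Hypothesis phi_ge0 : forall x, 0 <= phi x.
Hypothesis phi_cont : continuous phi.

(** [g_u] is affine in (x, phi x): the centred linear term integrates to 0, and the moment
    constraint makes the term carried by [lam.2 >= 0] nonpositive. *)
Lemma integral_g_le (mu : R) P (lam : R * R) :
    moment_class phi B mu P -> 0 <= lam.2 ->
  (\int[P]_x (g_u phi B lam (x - mu))%:E <= 1)%E.
Proof.
case=> iX EX Ephi lam_ge0.
have mphi : measurable_fun [set: measurableTypeR R] (fun x => phi (x - mu)).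
  apply: (@measurableT_comp _ _ _ _ _ _ phi); last exact: measurable_funB.
  exact: continuous_measurable_fun.
have iphi : P.-integrable [set: measurableTypeR R]
    (fun x : measurableTypeR R => (phi (x - mu))%:E).
  apply/integrableP; split; first exact/measurable_EFinP.
  under eq_integral do rewrite gee0_abs ?lee_fin//.
  by apply: (le_lt_trans Ephi); rewrite ltry.
have icst (c : R) : P.-integrable [set: measurableTypeR R] (cst c%:E).
  by apply/finite_measure_integrable_cst.
have -> : (fun x => (g_u phi B lam (x - mu))%:E) =
    (fun x : measurableTypeR R => ((lam.2)%:E * (phi (x - mu))%:E +
    ((lam.1)%:E * x%:E + cst (1 - lam.1 * mu - lam.2 * B)%:E x)))%E.
  by apply/funext => x; rewrite /g_u /= -!EFinM -!EFinD; congr EFin; ring.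
rewrite integralD//; last 2 first.
- exact: integrableZl.
- by apply: integrableD => //; exact: integrableZl.
rewrite integralD//; last exact: integrableZl.
rewrite !integralZl// EX integral_cst//.
rewrite [X in (_ + (_ + _ * X))%E](_ : _ = 1%E) ?mule1; last exact: probability_setT.
apply: (@le_trans _ _ (lam.2%:E * B%:E + (lam.1%:E * mu%:E +
   (1 - lam.1 * mu - lam.2 * B)%:E)))%E.
  by rewrite leeD2r// lee_wpmul2l// lee_fin.
by rewrite -!EFinM -!EFinD lee_fin; lra.
Qed.

Lemma iid_law_moment_class_le (mu : R) P (lam : R * R) (f : R -> R) (r : R) n :
    moment_class phi B mu P -> 0 <= lam.2 -> measurable_fun setT f ->
    (forall x, 0 < g_u phi B lam x) ->
    (forall x, f x <= ln (g_u phi B lam (x - mu)) - r) ->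
  (iid_law P n [set X : n.-tuple (measurableTypeR R) |
      (0 <= \sum_(i < n) f (tnth X i))%R]
   <= (expR (- r) ^+ n)%:E)%E.
Proof.
move=> mP lam_ge0 mf g_gt0 fg; apply: iid_law_chernoff => //.
have mg : measurable_fun [set: measurableTypeR R]
    (fun x => (g_u phi B lam (x - mu))%:E).
  apply/measurable_EFinP; apply: (@measurableT_comp _ _ _ _ _ _ (g_u phi B lam)).
    apply: measurable_funD; first by apply: measurable_funD; last exact: measurable_funM.
    apply: measurable_funM => //; apply: measurable_funB => //.
    exact: continuous_measurable_fun.
  exact: measurable_funB.
apply: (@le_trans _ _
  (\int[P]_x ((expR (- r))%:E * (g_u phi B lam (x - mu))%:E)))%E.
  apply: ge0_le_integral => //.
  - by apply/measurable_EFinP; exact: measurableT_comp.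
  - exact: emeasurable_funM.
  - move=> x _; rewrite -EFinM lee_fin -[X in _ * X]lnK ?posrE// -expRD.
    by rewrite ler_expR addrC.
rewrite ge0_integralZl_EFin ?expR_ge0//.
  rewrite -[leRHS]mule1 lee_wpmul2l ?lee_fin ?expR_ge0//.
  exact: integral_g_le.
by move=> x _; rewrite lee_fin ltW.
Qed.

End moment_bound.

(** * Error events of an M-estimator through its score *)

Section M_estimator_level.
Context (R : realType) (psi : R -> R).
Hypothesis psi_nd : {homo psi : x y / x <= y}.

Let score n (X : n.-tuple (measurableTypeR R)) theta :=
  \sum_(i < n) psi (tnth X i - theta).

Let score_ni n (X : n.-tuple (measurableTypeR R)) (s t : R) :
  s <= t -> score X t <= score X s.
Proof. by move=> st; apply: ler_sum => i _; apply: psi_nd; rewrite lerB. Qed.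

Let measurable_score n (t : R) : measurable_fun
  [set: n.-tuple (measurableTypeR R)] (fun X => score X t).
Proof.
apply: measurable_sum => i.
apply: (@measurableT_comp _ _ _ _ _ _ psi); first exact: nondecreasing_measurable.
by apply: measurable_funB => //; exact: measurable_tnth.
Qed.

(** The score is nonincreasing in theta, so the infimum exceeds [c] exactly when the score is still
    positive somewhere beyond [c]. Taking that point rational exhibits the event as a countable
    union, whence its measurability. *)
Lemma lt_M_estimator n (X : n.-tuple (measurableTypeR R)) (c : R) :
  (c%:E < M_estimator psi X)%E <-> exists2 q : rat, c < ratr q & 0 < score X (ratr q).
Proof.
split=> [cM|[q cq q_gt0]].
  have [q cq qM] : exists2 q : rat, c < ratr q & ((ratr q)%:E < M_estimator psi X)%E.
    case: (M_estimator psi X) cM => [m| |]//=.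
      by rewrite lte_fin => /rat_in_itvoo[q]; rewrite in_itv/= => /andP[? ?]; exists q.
    move=> _; have /rat_in_itvoo[q] : c < c + 1 by rewrite ltrDl.
    by rewrite in_itv/= => /andP[? _]; exists q; rewrite // ltry.
  exists q => //; rewrite ltNge; apply/negP => q_le0.
  by move: qM; rewrite ltNge => /negP; apply; apply: ereal_inf_lbound; exists (ratr q).
apply: (@lt_le_trans _ _ (ratr q)%:E); first by rewrite lte_fin.
apply: le_ereal_inf_tmp => _ [t /= t_le0 <-]; rewrite lee_fin leNgt; apply/negP => tq.
by have := lt_le_trans q_gt0 (le_trans (score_ni X (ltW tq)) t_le0); rewrite ltxx.
Qed.

Lemma M_estimator_lt n (X : n.-tuple (measurableTypeR R)) (c : R) :
  (M_estimator psi X < c%:E)%E <-> exists2 q : rat, ratr q < c & score X (ratr q) <= 0.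
Proof.
split=> [|[q qc q_le0]].
  move/ereal_inf_lt => [_ [t /= t_le0 <-]]; rewrite lte_fin => /rat_in_itvoo[q].
  rewrite in_itv/= => /andP[tq qc]; exists q => //.
  by apply: le_trans t_le0; exact/score_ni/ltW.
apply: (@le_lt_trans _ _ (ratr q)%:E); last by rewrite lte_fin.
by apply: ereal_inf_lbound; exists (ratr q).
Qed.

Lemma measurable_lt_M_estimator n (c : R) : measurable
  [set X : n.-tuple (measurableTypeR R) | (c%:E < M_estimator psi X)%E].
Proof.
rewrite (_ : [set X | _] = \bigcup_(q : rat)
    if c < ratr q then setT `&` (fun X => score X (ratr q)) @^-1` `]0, +oo[ else set0); last first.
  apply/seteqP; split => X /=.
    move/lt_M_estimator => [q cq qX]; exists q; rewrite // cq; split => //=.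
    by rewrite in_itv/= qX.
  move=> [q _]; case: ifP => //= cq [_ /=]; rewrite in_itv/= andbT => qX.
  by apply/lt_M_estimator; exists q.
by apply: bigcupT_measurable_rat => q; case: ifP => // _; exact: measurable_score.
Qed.

Lemma measurable_M_estimator_lt n (c : R) : measurable
  [set X : n.-tuple (measurableTypeR R) | (M_estimator psi X < c%:E)%E].
Proof.
rewrite (_ : [set X | _] = \bigcup_(q : rat)
    if ratr q < c then setT `&` (fun X => score X (ratr q)) @^-1` `]-oo, 0] else set0); last first.
  apply/seteqP; split => X /=.
    move/M_estimator_lt => [q cq qX]; exists q; rewrite // cq; split => //=.
  move=> [q _]; case: ifP => //= cq [_ /=]; rewrite in_itv/= => qX.
  by apply/M_estimator_lt; exists q.
by apply: bigcupT_measurable_rat => q; case: ifP => // _; exact: measurable_score.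
Qed.

Lemma worst_case_level_M_estimator_le (phi : R -> R) (B Delta : R)
    (lam : R * R) (r : R) n :
    (forall x, 0 <= phi x) -> continuous phi ->
    admissible phi B lam -> separates phi B Delta lam r psi ->
  (worst_case_level phi B (@M_estimator R psi n) Delta <= (expR (- r) ^+ n)%:E)%E.
Proof.
move=> phi0 phic [lam2 gpos] [_ psiP].
have mpsi c : measurable_fun [set: R] (fun x => psi (x - c)).
  apply: (@measurableT_comp _ _ _ _ _ _ psi); first exact: nondecreasing_measurable.
  exact: measurable_funB.
rewrite /worst_case_level ge_max; apply/andP; split;
  apply: ge_ereal_sup => _ [mu [P [mP ->]]].
- apply: le_trans (@iid_law_moment_class_le _ _ _ phi0 phic mu P lam
    (fun x => psi (x - (mu + Delta))) r n mP lam2 _ _ _) => //.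
  + apply: le_measure; rewrite ?inE.
    * exact: measurable_lt_M_estimator.
    * rewrite -[X in measurable X]setTI.
      rewrite (_ : [set X | _] = (fun X => score X (mu + Delta)) @^-1` `[0, +oo[).
        exact: measurable_score.
      by apply/seteqP; split => X /=; rewrite in_itv/= andbT.
    * move=> X /= /lt_M_estimator[q cq q_gt0].
      by apply/ltW/(lt_le_trans q_gt0); exact/score_ni/ltW.
  + by move=> x; case: (gpos x).
  + move=> x; have /andP[_] := psiP (x - (mu + Delta)); rewrite /psi_u.
    by rewrite (_ : x - (mu + Delta) + Delta = x - mu)//; ring.
(* The lower tail is an upper tail for [- psi], since negating [lam.1] exchanges [g_l] and [g_u]. *)
- apply: le_trans (@iid_law_moment_class_le _ _ _ phi0 phic mu P (- lam.1, lam.2)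
    (fun x => - psi (x - (mu - Delta))) r n mP lam2 _ _ _) => //.
  + apply: le_measure; rewrite ?inE.
    * exact: measurable_M_estimator_lt.
    * rewrite -[X in measurable X]setTI.
      rewrite (_ : [set X | _] = (fun X => score X (mu - Delta)) @^-1` `]-oo, 0]).
        exact: measurable_score.
      by apply/seteqP; split => X /=; rewrite in_itv/= sumrN oppr_ge0.
    * move=> X /= /M_estimator_lt[q cq q_le0]; rewrite sumrN oppr_ge0.
      by apply: le_trans q_le0; exact/score_ni/ltW.
  + exact: measurable_funN.
  + by move=> x; case: (gpos x) => _; rewrite /g_l /g_u /= mulNr.
  + move=> x; have /andP[+ _] := psiP (x - (mu - Delta)); rewrite /psi_l.
    rewrite (_ : x - (mu - Delta) - Delta = x - mu); last by ring.
    by rewrite /g_l /g_u /= mulNr; lra.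
Qed.

End M_estimator_level.

(** * Consequences of slow variation *)

Section real_derivatives.
Context (R : realType).
Implicit Types (f df : R -> R).

Lemma is_derive_ge0_homo f df (a : R) :
    (forall x, a < x -> is_derive x 1 f (df x)) ->
    (forall x, a < x -> 0 <= df x) ->
  forall x y, a < x -> x <= y -> f x <= f y.
Proof.
move=> fdf df0 x y ax xy.
have [z|c|c cxy /eqP] := @MVT_segment R f df x y xy.
- by rewrite in_itv/= => /andP[xz _]; apply/fdf/(lt_trans ax).
- apply: derivable_within_continuous => z; rewrite in_itv/= => /andP[xz _].
  by apply: (@ex_derive _ _ _ _ _ _ (df z)); exact/fdf/(lt_le_trans ax).
rewrite subr_eq => /eqP ->; rewrite lerDr mulr_ge0 ?subr_ge0//.
by apply/df0/(lt_le_trans ax); move: cxy; rewrite in_itv/= => /andP[].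
Qed.

Lemma is_derive_within f (a x l : R) : a < x ->
    (f y - f x) / (y - x) @[y --> within `[a, +oo[%classic x^'] --> l ->
  is_derive x 1 f l.
Proof.
move=> ax fl; apply/is_derive1_caratheodory.
exists (fun y => if y == x then l else (f y - f x) / (y - x)); split.
- move=> z; case: eqVneq => [->|zx]; first by rewrite !subrr mulr0.
  by rewrite divfK// subr_eq0.
- apply/continuous_withinNx; rewrite eqxx => U /fl /= Ul.
  have Ux : \forall y \near x^', `[a, +oo[%classic y.
    apply: nbhs_dnbhs; have /near_in_itvoy : x \in `]a, +oo[ by rewrite in_itv/= ax.
    by apply: filterS => y; rewrite /= !in_itv/= !andbT => /ltW.
  apply: filterS3 (nbhs_dnbhs_neq x) Ul Ux => y /= /negbTE yx + ay.
  by rewrite yx; apply.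
- by rewrite eqxx.
Qed.

(** Serves at the endpoint [xinf]: right continuity of [eta] there makes [eta u / u] continuous,
    hence integrable, on segments starting at [xinf]. *)
Lemma cvg_at_right_within f (a l : R) :
    (f y - f a) / (y - a) @[y --> within `[a, +oo[%classic a^'] --> l ->
  f y @[y --> a^'+] --> f a.
Proof.
move=> fl.
have fl' : (f y - f a) / (y - a) @[y --> a^'+] --> l.
  move=> U /fl /= Ul; rewrite /at_right /= in Ul *.
  have {}Ul : \forall y \near a, y != a -> `[a, +oo[%classic y ->
      U ((f y - f a) / (y - a)) by exact: Ul.
  have : \forall y \near a, a < y -> U ((f y - f a) / (y - a)).
    apply: filterS Ul => y Uy ay; apply: Uy; first by rewrite gt_eqF.
    by rewrite /= in_itv/= ltW.
  by [].
have : (f y - f a) / (y - a) * (y - a) + f a @[y --> a^'+] --> l * (a - a) + f a.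
  apply: cvgD; last exact: cvg_cst.
  apply: cvgM => //; apply: cvgB; last exact: cvg_cst.
  exact: cvg_at_right_filter.
rewrite subrr mulr0 add0r; apply: cvg_trans; apply: near_eq_cvg.
near=> y; rewrite divfK ?subrK// subr_eq0.
by rewrite gt_eqF//; near: y; exact: nbhs_right_gt.
Unshelve. all: by end_near. Qed.

End real_derivatives.

(* Locked so that failing comparisons of distinct values do not unfold the
   integral. *)
HB.lock Definition log_Lambda (R : realType) (xinf : R) (eta : R -> R) (x : R) : R :=
  \int[lebesgue_measure]_(u in `[xinf, x]) (eta u / u).

(** The right side of (A2) as a total function; it equals [Lambda phi] from [xinf] on. *)
HB.lock Definition Lam (R : realType) (xinf Lambda0 : R) (eta : R -> R) (x : R) : R :=
  Lambda0 * expR (log_Lambda xinf eta x).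

(** The power against which slow variation is measured: beyond some point [Lam] grows no faster than
    it, and [eta] decays no faster than its inverse. *)
HB.lock Definition quartic_root (R : realType) (x : R) : R := expR (ln x / 4).

Section slowly_varying.
Context (R : realType) (phi : R -> R) (B xinf Lambda0 : R) (eta deta : R -> R).
Hypothesis hphi : slowly_varying_moment_class phi B xinf Lambda0 eta deta.

Let xinf_gt0 : 0 < xinf. Proof. exact: lt_trans (svm_xinf_gt1 hphi). Qed.

Lemma is_derive_eta x : xinf < x -> is_derive x 1 eta (deta x).
Proof.
move=> xx; apply: (is_derive_within xx).
by apply: (svm_eta_C1 hphi).1; rewrite /= in_itv/= ltW.
Qed.

Let eta_div_continuous x : xinf < x -> {for x, continuous (fun u => eta u / u)}.
Proof.
move=> xx; apply: cvgM; last first.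
  by apply: cvgV; [rewrite gt_eqF// (lt_trans xinf_gt0)|exact: cvg_id].
apply/differentiable_continuous/derivable1_diffP.
by have [] := is_derive_eta xx.
Qed.

Let eta_div_integrable u : xinf < u ->
  lebesgue_measure.-integrable `[xinf, u] (EFin \o (fun u => eta u / u)).
Proof.
move=> xu; apply: continuous_compact_integrable; first exact: segment_compact.
apply/continuous_within_itvP => //; split.
- by move=> x; rewrite in_itv/= => /andP[xx _]; exact: eta_div_continuous.
- apply: cvgM.
    apply: (@cvg_at_right_within _ _ _ (deta xinf)).
    by apply: (svm_eta_C1 hphi).1; rewrite /= in_itv/= lexx.
  apply: cvgV; first by rewrite gt_eqF.
  exact: cvg_at_right_filter.
- by apply: cvg_at_left_filter; exact: eta_div_continuous.
Qed.

Local Notation log_Lambda := (log_Lambda xinf eta).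
Local Notation Lam := (Lam xinf Lambda0 eta).

Lemma is_derive_log_Lambda x : xinf < x -> is_derive x 1 log_Lambda (eta x / x).
Proof.
move=> xx.
have x1 : x < x + 1 by rewrite ltrDl.
have [] := @continuous_FTC1 R (fun u => eta u / u) (BLeft xinf) x (x + 1) x1.
- exact/eta_div_integrable/(lt_trans xx).
- by rewrite /= lte_fin.
- exact: eta_div_continuous.
rewrite (_ : log_Lambda = fun y => \int[lebesgue_measure]_(u in `[xinf, y]) (eta u / u)).
  by move=> dF /[!derive1E] <-; split.
by apply/funext => y; rewrite log_Lambda.unlock.
Qed.

Lemma Lam_gt0 x : 0 < Lam x.
Proof. by rewrite Lam.unlock mulr_gt0 ?expR_gt0// (svm_Lambda0_gt0 hphi). Qed.

Lemma Lambda_Lam x : xinf <= x -> Lambda phi x = Lam x.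
Proof. by move=> xx; rewrite Lam.unlock log_Lambda.unlock (svm_Lambda hphi). Qed.

Lemma phiE x : xinf <= x -> phi x = x * Lam x.
Proof.
move=> xx; have x0 := lt_le_trans xinf_gt0 xx.
by rewrite -Lambda_Lam// /Lambda gtr0_norm// mulrC divfK// gt_eqF.
Qed.

Lemma LamE x : Lam x = expR (ln Lambda0 + log_Lambda x).
Proof. by rewrite Lam.unlock expRD lnK// posrE (svm_Lambda0_gt0 hphi). Qed.

Lemma log_Lambda_nd x y : xinf < x -> x <= y -> log_Lambda x <= log_Lambda y.
Proof.
apply: (is_derive_ge0_homo is_derive_log_Lambda) => {}x xx.
have x0 := lt_trans xinf_gt0 xx.
by rewrite ltW// divr_gt0// (svm_eta_gt0 hphi)// ltW.
Qed.

Lemma Lam_nd x y : xinf < x -> x <= y -> Lam x <= Lam y.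
Proof.
by move=> xx xy; rewrite !LamE ler_expR lerD2l; exact: log_Lambda_nd.
Qed.

Lemma quartic_root_gt0 (x : R) : 0 < quartic_root x.
Proof. by rewrite quartic_root.unlock expR_gt0. Qed.

Lemma quartic_rootX4 (x : R) : 0 < x -> quartic_root x ^+ 4 = x.
Proof.
move=> x0; rewrite quartic_root.unlock -expRM_natl -mulr_natl mulrC divfK ?lnK ?posrE//.
Qed.

(** * Potter-type bounds and convexity beyond a point [a] *)

Section eventual.
Variable a : R.
Hypothesis xinf_a : xinf <= a.
Hypothesis eta_small : forall x, a < x -> eta x <= 4^-1.
Hypothesis eta_slow : forall x, a < x -> `|x * deta x / eta x| <= 4^-1.

Let a_gt0 : 0 < a. Proof. exact: lt_le_trans xinf_a. Qed.
Let a_xinf x : a < x -> xinf < x. Proof. exact: le_lt_trans. Qed.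
Let a_pos x : a < x -> 0 < x. Proof. exact: lt_trans. Qed.
Let eta_pos x : a < x -> 0 < eta x.
Proof. by move=> ax; rewrite (svm_eta_gt0 hphi)// ltW// a_xinf. Qed.

Let is_derive_ln_eta x : a < x ->
  is_derive x 1 (fun u => ln (eta u)) (deta x / eta x).
Proof.
move=> ax; rewrite mulrC; apply: is_derive1_comp; last exact/is_derive_eta/a_xinf.
exact/is_derive1_ln/eta_pos.
Qed.

(** The logarithm has derivative (u eta'(u) / eta(u) + 1/4) / u, nonnegative by [eta_slow]. *)
Lemma eta_quartic_root_nd (x y : R) : a < x -> x <= y ->
  eta x * quartic_root x <= eta y * quartic_root y.
Proof.
have H : forall x y, a < x -> x <= y ->
    ln (eta x) + 4^-1 * ln x <= ln (eta y) + 4^-1 * ln y.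
  apply: (@is_derive_ge0_homo R _ (fun x => deta x / eta x + 4^-1 * x^-1)).
    move=> u au; apply: is_deriveD; first exact: is_derive_ln_eta.
    exact/is_deriveZ/is_derive1_ln/a_pos.
  move=> u au; have := eta_slow au; rewrite ler_norml => /andP[+ _].
  have e0 := eta_pos au; have u0 := a_pos au => h.
  have -> : deta u / eta u + 4^-1 * u^-1 = (u * deta u / eta u + 4^-1) / u.
    by field; rewrite !gt_eqF.
  by apply: divr_ge0; [lra|exact: ltW].
move=> ax xy; have ay := lt_le_trans ax xy.
rewrite -ler_ln ?posrE ?mulr_gt0 ?quartic_root_gt0 ?eta_pos//.
rewrite !lnM ?posrE ?quartic_root_gt0 ?eta_pos// quartic_root.unlock !expRK.
by have := H x y ax xy; lra.
Qed.

(** The logarithm has derivative (eta(u) - 1/4) / u, nonpositive by [eta_small]. *)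
Lemma Lam_quartic_root_ni (x y : R) : a < x -> x <= y ->
  Lam y / quartic_root y <= Lam x / quartic_root x.
Proof.
pose h x := 4^-1 * ln x - log_Lambda x.
have H : forall x y, a < x -> x <= y -> h x <= h y.
  apply: (@is_derive_ge0_homo R _ (fun x => 4^-1 * x^-1 - eta x / x)).
    move=> u au; apply: is_deriveB; last exact/is_derive_log_Lambda/a_xinf.
    exact/is_deriveZ/is_derive1_ln/a_pos.
  move=> u au; rewrite -mulrBl mulr_ge0 ?subr_ge0 ?eta_small//.
  by rewrite invr_ge0 ltW// a_pos.
have E u : Lam u / quartic_root u = expR (ln Lambda0 - h u).
  by rewrite LamE quartic_root.unlock -expRB /h opprB addrA [4^-1 * _]mulrC.
by move=> ax xy; rewrite (E y) (E x) ler_expR lerD2l lerN2; exact: H.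
Qed.

(** [Lam u * (1 + eta u)] is the derivative of u Lam(u) = phi(u), so this is convexity of [phi]
    beyond [a]. Its logarithmic derivative has the sign of 1 + eta(u) + u eta'(u) / eta(u), which is
    at least 3/4. *)
Lemma Lam_eta_nd x y : a < x -> x <= y ->
  Lam x * (1 + eta x) <= Lam y * (1 + eta y).
Proof.
pose h u := log_Lambda u + ln (1 + eta u).
have H : forall x y, a < x -> x <= y -> h x <= h y.
  apply: (@is_derive_ge0_homo R _ (fun x => eta x / x + (1 + eta x)^-1 * (0 + deta x))).
    move=> u au; apply: is_deriveD; first exact/is_derive_log_Lambda/a_xinf.
    apply: is_derive1_comp.
      by apply: is_derive1_ln; rewrite addr_gt0 ?eta_pos.
    by apply: is_deriveD; exact/is_derive_eta/a_xinf.
  move=> u au; have := eta_slow au; rewrite ler_norml => /andP[+ _].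
  have e0 := eta_pos au; have u0 := a_pos au.
  rewrite add0r => h1.
  have -> : eta u / u + (1 + eta u)^-1 * deta u =
      (eta u / u) * (1 + eta u)^-1 * (1 + eta u + u * deta u / eta u).
    by field; rewrite !gt_eqF// addr_gt0.
  apply: mulr_ge0; last by lra.
  by rewrite ltW// mulr_gt0 ?invr_gt0 ?divr_gt0 ?addr_gt0.
have E u : a < u -> Lam u * (1 + eta u) = expR (ln Lambda0 + h u).
  by move=> au; rewrite addrA expRD -LamE lnK// posrE addr_gt0 ?eta_pos.
move=> ax xy; rewrite (E _ ax) (E _ (lt_le_trans ax xy)) ler_expR lerD2l.
exact: H.
Qed.

(** Convexity, through the mean value theorem on either side of [y]. *)
Lemma phi_ge_tangent x y : a < x -> a < y ->
  phi y + Lam y * (1 + eta y) * (x - y) <= phi x.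
Proof.
have dphi u : a < u ->
    is_derive u 1 (fun u => u * Lam u) (Lam u * (1 + eta u)).
  move=> au; have -> : Lam u * (1 + eta u) =
      u *: (Lambda0 *: (expR (log_Lambda u) * (eta u / u))) + Lam u *: (1 : R).
    by rewrite /GRing.scale /= Lam.unlock; field; rewrite gt_eqF ?a_pos.
  apply: is_deriveM; rewrite (_ : Lam = fun v => Lambda0 * expR (log_Lambda v)); last first.
    by apply/funext => v; rewrite Lam.unlock.
  apply: is_deriveZ.
  by apply: is_derive1_comp; exact/is_derive_log_Lambda/a_xinf.
have phiE' u : a < u -> phi u = u * Lam u by move=> au; rewrite phiE ?ltW ?a_xinf.
have mvt u v : a < u -> u <= v ->
    exists2 c, u <= c <= v & phi v - phi u = Lam c * (1 + eta c) * (v - u).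
  move=> au uv; have av := lt_le_trans au uv; rewrite !phiE'//.
  have [z|c|c cuv ->] := @MVT_segment R (fun u => u * Lam u)
      (fun u => Lam u * (1 + eta u)) u v uv.
  - by rewrite in_itv/= => /andP[uz _]; apply/dphi/(lt_trans au).
  - apply: derivable_within_continuous => w; rewrite in_itv/= => /andP[uz _].
    by have [] := dphi w (lt_le_trans au uz).
  - by exists c; move: cuv; rewrite // in_itv.
move=> ax ay; have [xy|/ltW yx] := leP x y.
  have [c /andP[xc cy]] := mvt x y ax xy.
  have ac := lt_le_trans ax xc.
  have := Lam_eta_nd ac cy => h1 h2.
  have : 0 <= (Lam y * (1 + eta y) - Lam c * (1 + eta c)) * (y - x).
    by rewrite mulr_ge0// subr_ge0.
  by lra.
have [c /andP[yc cx]] := mvt y x ay yx.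
have := Lam_eta_nd ay yc => h1 h2.
have : 0 <= (Lam c * (1 + eta c) - Lam y * (1 + eta y)) * (x - y).
  by rewrite mulr_ge0// subr_ge0.
by lra.
Qed.

(** For u <= y, [eta_quartic_root_nd] bounds eta(u) by eta(y) (y / u)^(1/4); integrating against du
    / u from x to y gives at most 4 eta(y) ((y / x)^(1/4) - 1). This limits how far [Lam x] can lie
    below [Lam y]. *)
Lemma log_Lambda_potter (x y : R) : a < x -> x <= y ->
  log_Lambda y - log_Lambda x <= 4 * eta y * quartic_root y / quartic_root x.
Proof.
move=> ax xy; have ay := lt_le_trans ax xy.
(* The factor 4 makes -C u^(-1/4) a primitive of the majorant of eta(u) / u; [h] is that primitive
   minus [log_Lambda], hence nondecreasing up to [y]. *)
set C := 4 * eta y * quartic_root y.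
pose h u := - (C * expR (- (4^-1 * ln u)) + log_Lambda u).
pose dh u := - (C * (expR (- (4^-1 * ln u)) * - (4^-1 * u^-1)) + eta u / u).
have dhP u : a < u -> is_derive u 1 h (dh u).
  move=> au; apply: is_deriveN; apply: is_deriveD; last exact/is_derive_log_Lambda/a_xinf.
  apply: is_deriveZ; apply: is_derive1_comp; apply: is_deriveN; apply: is_deriveZ.
  exact/is_derive1_ln/a_pos.
have dh0 u : a < u -> u <= y -> 0 <= dh u.
  move=> au uy; rewrite /dh.
  have := eta_quartic_root_nd au uy; rewrite -ler_pdivlMr ?quartic_root_gt0// => hu.
  have -> : expR (- (4^-1 * ln u)) = (quartic_root u)^-1.
    by rewrite quartic_root.unlock -expRN [_ / 4]mulrC.
  have : 0 <= (eta y * quartic_root y / quartic_root u - eta u) / u.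
    by rewrite divr_ge0 ?subr_ge0// ltW// a_pos.
  by rewrite /C; lra.
have [z|c|c cxy] := @MVT_segment R h dh x y xy.
- by rewrite in_itv/= => /andP[uz _]; apply/dhP/(lt_trans ax).
- apply: derivable_within_continuous => w; rewrite in_itv/= => /andP[uz _].
  by have [] := dhP w (lt_le_trans ax uz).
move: cxy; rewrite in_itv/= => /andP[xc cy].
rewrite /h => hE.
have : 0 <= dh c * (y - x).
  by rewrite mulr_ge0 ?subr_ge0// dh0// (lt_le_trans ax xc).
rewrite -hE.
have E u : expR (- (4^-1 * ln u)) = (quartic_root u)^-1.
  by rewrite quartic_root.unlock -expRN [_ / 4]mulrC.
rewrite !E; have : 0 <= C / quartic_root y.
  by rewrite !mulr_ge0 ?invr_ge0 ?ltW// ?quartic_root_gt0// eta_pos.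
by lra.
Qed.

End eventual.
End slowly_varying.

(** * Barriers of the tilted multipliers *)

Section separation.
Context (R : realType) (phi : R -> R) (B : R).
Hypothesis phi_even : forall x, phi (- x) = phi x.

Let g_lE lam x : g_l phi B lam x = g_u phi B lam (- x).
Proof. by rewrite /g_l /g_u phi_even mulrN. Qed.

(** The score at [y] is the supremum over x <= y of the lower barrier raised by [r], the least
    nondecreasing function above it. It stays below the upper barrier as soon as that barrier at [y]
    dominates the lower one at every x <= y; by evenness this compares [g_u] at [Delta - x] and at
    [y + Delta], whose sum is at least [2 * Delta]. *)
Lemma exists_separates (Delta r : R) (lam : R * R) :
    admissible phi B lam ->
    (forall s t, 2 * Delta <= s + t ->
      expR (2 * r) <= g_u phi B lam s * g_u phi B lam t) ->
  exists psi, separates phi B Delta lam r psi.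
Proof.
move=> [_ gpos] gg.
pose L x := psi_l phi B Delta lam x + r.
have LU x y : x <= y -> L x <= psi_u phi B Delta lam y - r.
  move=> xy; rewrite /L /psi_l /psi_u g_lE.
  have gu z : 0 < g_u phi B lam z by case: (gpos z).
  have : 2 * Delta <= - (x - Delta) + (y + Delta) by lra.
  move/gg; rewrite -ler_ln ?posrE ?expR_gt0 ?mulr_gt0// expRK.
  by rewrite lnM ?posrE//; lra.
pose S y := [set L x | x in [set x | x <= y]].
have S_ub y : ubound (S y) (psi_u phi B Delta lam y - r).
  by move=> _ [x /= xy <-]; exact: LU.
have S0 y : S y !=set0 by exists (L y), y => /=.
have S_sup y : has_sup (S y) by split; [exact: S0|eexists; exact: S_ub].
exists (fun y => sup (S y)); split=> [x y xy|y].
  apply: sup_le (S0 x) (S_sup y) => _ [z /= zx <-]; exists (L z); split=> //.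
  by exists z => //=; exact: le_trans xy.
apply/andP; split; last exact: ge_sup (S0 y) (S_ub y).
by apply: (sup_upper_bound (S_sup y)); exists y => /=.
Qed.

End separation.

(** With t = 2 k' q, exp(-t) >= 1 - t gives exp(t) <= 1 / (1 - t). The coefficient k + k' exceeds 2
    k' by k - k', which absorbs the second-order term for small [q]. *)
Lemma expR_le_1Dx (R : realType) (k k' q : R) : 0 <= k' -> k' < k -> k < 1 ->
  0 <= q -> q <= (k - k') / 4 -> expR (2 * k' * q) <= 1 + (k + k') * q.
Proof.
move=> k'0 kk' k1 q0 qk.
have kq : 0 <= k' * q by rewrite mulr_ge0.
have h1 : 0 < 1 - 2 * k' * q.
  have : k' * q <= 1 * ((k - k') / 4) by apply: ler_pM => //; lra.
  by lra.
have h2 := expR_ge1Dx (- (2 * k' * q)).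
rewrite expRN in h2.
have h3 : expR (2 * k' * q) * (1 - 2 * k' * q) <= 1.
  by rewrite -ler_pdivlMl ?expR_gt0// mulr1.
rewrite -(@ler_pM2r _ (1 - 2 * k' * q))//; apply: (le_trans h3).
have : (k' * (k + k')) * q <= 2 * ((k - k') / 4).
  apply: ler_pM => //; first by rewrite mulr_ge0//; lra.
  have : k' * (k + k') <= 1 * 2 by apply: ler_pM => //; lra.
  by lra.
move=> h4; have : 0 <= q * ((k - k') - 2 * (k' * (k + k') * q)).
  by rewrite mulr_ge0//; lra.
by lra.
Qed.

(* With [c = 1 - b B], [y = a x], [p = b phi x] and [w = a Delta], the product
   below is [g(-x) g(x + 2 Delta)] up to terms of the right sign; its value at
   [x = 0] is [c ^+ 2 + 2 * c * w]. *)
Lemma barrier_product_ge (R : realType) (T k d c p y w : R) :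
    k < 1 -> 0 < d <= (1 - k) / 64 -> 0 <= k ->
    3 / 4 <= c <= 1 -> 0 <= p -> 0 <= y -> 0 <= w <= 1 -> T <= 2 ->
    T <= c ^+ 2 + 2 * c * w ->
    [\/ y ^+ 2 + 2 * y * w <= c ^+ 2 + 2 * c * w - T,
        y ^+ 2 + 2 * y * w <= p |
        (1 - 2 * d) * y <= p /\ (1 - k) / 2 <= c + p - y] ->
  T <= (c + p - y) * (c + p + y + 2 * w).
Proof.
move=> k1 /andP[d0 dk] k0 /andP[c34 c1] p0 y0 /andP[w0 w1] T2 Tc.
have E : (c + p - y) * (c + p + y + 2 * w) =
  (c ^+ 2 + 2 * c * w) + (2 * c * p + p ^+ 2 + 2 * w * p) - (y ^+ 2 + 2 * y * w).
  by ring.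
have p2 : 0 <= p ^+ 2 by rewrite sqr_ge0.
have wp : 0 <= w * p by rewrite mulr_ge0.
have cp : 3 / 4 * p <= c * p by rewrite ler_wpM2r.
case=> [h|h|[h1 h2]].
- by rewrite E; lra.
- by rewrite E; lra.
(* For [y >= 4 / (1 - k)] the two factors are at least [(1 - k) / 2] and [y], so their product is at
   least 2. *)
have [yk|yk] := leP (4 / (1 - k)) y.
  have {}yk : 4 <= (1 - k) * y by rewrite mulrC -ler_pdivrMr// subr_gt0.
  apply: (@le_trans _ _ ((1 - k) / 2 * y)); first by lra.
  by apply: ler_pM => //; lra.
have dy : d * y <= 1 / 16.
  apply: (@le_trans _ _ ((1 - k) / 64 * (4 / (1 - k)))).
    by apply: ler_pM => //; lra.
  by rewrite le_eqVlt; apply/orP; left; apply/eqP; field; lra.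
(* For bounded [y], [p] falls short of [y] by at most [2 * d * y]. The resulting loss, of order d
   y^2 + d y w, is paid by the term [2 * c * p], since [d * y] and [d * w] are small. *)
rewrite E; have [yp|py] := leP y p.
  have : 0 <= (p - y) * (p + y) by rewrite mulr_ge0; lra.
  have : 0 <= (p - y) * w by rewrite mulr_ge0; lra.
  by lra.
have dw : d * w <= 1 / 64 by apply: (@le_trans _ _ (d * 1)); [rewrite ler_wpM2l; lra|lra].
have h3 : y ^+ 2 - p ^+ 2 <= 4 * d * y * y.
  rewrite subr_sqr; apply: (@le_trans _ _ ((2 * d * y) * (2 * y))); last by lra.
  by apply: ler_pM; lra.
have h4 : (y - p) * w <= (2 * d * y) * w by rewrite ler_wpM2r//; lra.
have h5 : 0 <= y * (1 - 4 * (d * y) - 4 * (d * w)) by rewrite mulr_ge0//; lra.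
have d64 : d <= 1 / 64 by lra.
have h6 : d * y <= 1 / 64 * y by rewrite ler_wpM2r.
by lra.
Qed.

(** * The product inequality for the tilted multipliers *)

Section tilted_multiplier.
Context (R : realType) (phi : R -> R) (B : R).
Hypothesis phi_ge0 : forall x, 0 <= phi x.
Hypothesis phi_even : forall x, phi (- x) = phi x.
Hypothesis phi_nd : forall x y, 0 <= x -> x <= y -> phi x <= phi y.
Variables (k k' d x1 X L e : R).
Hypotheses (B_gt0 : 0 < B) (k'_ge0 : 0 <= k') (k'k : k' < k) (k1 : k < 1).
Hypotheses (d_gt0 : 0 < d) (dk : d <= (1 - k) / 64) (x1_ge1 : 1 <= x1).
Hypotheses (X_gt0 : 0 < X) (L_gt0 : 0 < L) (e_gt0 : 0 < e) (ed : e <= d).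

Variables (q Delta a b : R).
Hypotheses (qE : q = B / (X * L)) (DeltaE : Delta = B / L).
Hypotheses (aE : a = k * (1 + e) / (e * X)) (bE : b = k / (e * X * L)).

Hypotheses (q_small : q <= (k - k') / 4) (qe_small : q / e <= (1 - k) / 4).
Hypothesis qe2_small : q / e ^+ 2 <= (k - k') / 16.
Hypotheses (ax1_small : a * x1 <= 1 / 4) (Delta_le1 : Delta <= 1).
Hypothesis a_small :
  (a * x1) ^+ 2 + 2 * (a * x1) * (a * Delta) <= (k - k') / 2 * q.
Hypothesis phi_tangent : forall x, x1 < x ->
  X * L + L * (1 + e) * (x - X) <= phi x.
(** The first case will come from points far below [X], the second from those where [Lambda phi] has
    nearly reached or passed [L]. *)
Hypothesis phi_dichotomy : forall x, x1 < x ->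
  3 * (a * x) ^+ 2 <= b * phi x \/ (1 - d) * (L * x) <= phi x.

Let k_gt0 : 0 < k. Proof. exact: le_lt_trans k'k. Qed.
Let q_gt0 : 0 < q. Proof. by rewrite qE divr_gt0 ?mulr_gt0. Qed.
Let Delta_gt0 : 0 < Delta. Proof. by rewrite DeltaE divr_gt0. Qed.
Local Ltac slra := have := k_gt0; have := q_gt0; have := Delta_gt0;
  have := k'_ge0; have := k'k; have := k1; have := d_gt0; have := dk;
  have := x1_ge1; have := e_gt0; have := ed; have := q_small;
  have := Delta_le1; have := ax1_small; lra.

Let e1 : e <= 1. Proof. slra. Qed.
Let a_gt0 : 0 < a.
Proof. by rewrite aE divr_gt0 ?mulr_gt0 ?addr_gt0. Qed.
Let b_gt0 : 0 < b. Proof. by rewrite bE divr_gt0 ?mulr_gt0. Qed.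
Local Notation c := (1 - b * B).
Local Notation w := (a * Delta).

Let bBE : b * B = k * (q / e).
Proof. by rewrite bE qE; field; rewrite !gt_eqF. Qed.

Let wE : w = b * B + k * q.
Proof. by rewrite bBE aE qE DeltaE; field; rewrite !gt_eqF. Qed.

Let bB_ge0 : 0 <= b * B. Proof. by rewrite mulr_ge0 ?ltW. Qed.

Let bB_small : b * B <= (1 - k) / 4.
Proof.
rewrite bBE; apply: le_trans qe_small; rewrite ger_pMl.
  exact: ltW.
exact: divr_gt0.
Qed.

Let w01 : 0 <= w <= 1.
Proof.
rewrite wE; apply/andP; split; first by rewrite addr_ge0// mulr_ge0// ltW.
have : k * q <= 1 * ((k - k') / 4).
  by apply: ler_pM; slra.
by have := bB_small; slra.
Qed.

Local Notation T := (1 + (k + k') * q).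

(** By [wE], c^2 + 2 c w = 1 + 2 k q + (b B)^2 - 2 w b B. The cross term has order q times q / e^2,
    so [qe2_small] keeps it below a quarter of (k - k') q. *)
Let T_base : (k - k') / 2 * q <= c ^+ 2 + 2 * c * w - T.
Proof.
have wbB : w * (b * B) <= (k - k') * q / 8.
  have -> : w * (b * B) = k ^+ 2 * (1 + e) * (q * (q / e ^+ 2)).
    by rewrite wE bBE; field; rewrite !gt_eqF.
  apply: (@le_trans _ _ (2 * (q * ((k - k') / 16)))); last by slra.
  apply: ler_pM; first by rewrite mulr_ge0 ?sqr_ge0//; slra.
  - by rewrite mulr_ge0 ?divr_ge0 ?sqr_ge0// ltW.
  - apply: (@le_trans _ _ (1 * 2)); last by slra.
    apply: ler_pM => //; rewrite ?sqr_ge0//; try slra.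
    by rewrite expr_le1// ltW.
  - by rewrite ler_wpM2l// ltW.
have := sqr_ge0 (b * B); move=> h.
have : 0 <= (k - k') * q by rewrite mulr_ge0 ?(ltW q_gt0)//; slra.
have := wE; slra.
Qed.

Local Notation g := (g_u phi B (a, b)).

Let gE x : g x = c + b * phi x + a * x.
Proof. by rewrite /g_u /=; ring. Qed.

Let bphi_ge0 x : 0 <= b * phi x. Proof. by rewrite mulr_ge0// ltW. Qed.

(** Scaled by [b], the tangent of [phi] at [X] is exactly [a * x - k], which explains the choice of
    [a] and [b]. What remains is 1 - k - b B. *)
Let g_tangent x : x1 < x -> (1 - k) / 2 <= c + b * phi x - a * x.
Proof.
move=> xx; have := ler_wpM2l (ltW b_gt0) (phi_tangent xx).
have -> : b * (X * L + L * (1 + e) * (x - X)) = a * x - k.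
  by rewrite bE aE; field; rewrite !gt_eqF.
by move=> h; have := bB_small; slra.
Qed.

Let g_gt0 x : 0 < g x.
Proof.
have := bphi_ge0 x; have := bB_small; rewrite gE => h1 h2.
have [x0|x0] := leP 0 x.
  by have := mulr_ge0 (ltW a_gt0) x0; slra.
have [xx1|xx1] := leP (- x) x1.
  have : a * (- x) <= a * x1 by rewrite ler_wpM2l// ltW.
  by slra.
by have := g_tangent xx1; rewrite phi_even; slra.
Qed.

(** As [phi] and the linear term increase, g(t) is at least c + b phi(x) + a x + 2 w, which reduces
    the claim to [barrier_product_ge]. Its three alternatives correspond to x <= x1 and to the two
    cases of [phi_dichotomy]. *)
Let g_product_neg x t : 0 < x -> 2 * Delta <= t - x -> T <= g (- x) * g t.
Proof.
move=> x0 xt; rewrite gE phi_even mulrN.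
have ax0 : 0 <= a * x by rewrite mulr_ge0// ltW.
have t_ge : c + b * phi x + a * x + 2 * w <= g t.
  have : b * phi x <= b * phi t.
    by rewrite ler_wpM2l ?(ltW b_gt0)// phi_nd//; have := Delta_gt0; slra.
  have : a * (x + 2 * Delta) <= a * t by rewrite ler_wpM2l ?(ltW a_gt0)//; slra.
  by rewrite gE; slra.
apply: (@le_trans _ _ ((c + b * phi x - a * x) *
    (c + b * phi x + a * x + 2 * w))); last first.
  apply: ler_wpM2l t_ge; have := g_gt0 (- x).
  by rewrite gE phi_even mulrN => /ltW.
have := T_base; have := bB_small; have [w0 w1] := andP w01 => hb hT.
have := bB_ge0 => hb0.
have qk0 : 0 <= (k - k') * q by rewrite mulr_ge0 ?(ltW q_gt0)//; slra.
apply: (@barrier_product_ge _ _ k d) => //.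
- by rewrite d_gt0.
- exact: ltW.
- by slra.
- have : (k + k') * q <= 2 * (1 / 4) by apply: ler_pM; slra.
  by slra.
- by slra.
have [xx1|xx1] := leP x x1.
  apply: Or31; apply: le_trans T_base; apply: le_trans a_small.
  have axx : a * x <= a * x1 by rewrite ler_wpM2l// ltW.
  have : (a * x) ^+ 2 <= (a * x1) ^+ 2 by rewrite lerXn2r ?nnegrE//; slra.
  have : (a * x) * w <= (a * x1) * w by rewrite ler_wpM2r.
  by slra.
have [h|h] := phi_dichotomy xx1.
  apply: Or32; apply: le_trans h.
  have : w <= a * x by rewrite ler_wpM2l ?(ltW a_gt0)//; slra.
  move/(ler_wpM2l ax0); slra.
apply: Or33; split; last exact: g_tangent.
have := ler_wpM2l (ltW b_gt0) h; apply: le_trans.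
have -> : b * ((1 - d) * (L * x)) = (1 - d) / (1 + e) * (a * x).
  by rewrite bE aE; field; rewrite !gt_eqF// addr_gt0.
rewrite ler_wpM2r// ler_pdivlMr ?addr_gt0//.
have : 0 <= d * e by rewrite mulr_ge0 ?ltW.
by slra.
Qed.

Let g_product s t : 2 * Delta <= s + t -> T <= g s * g t.
Proof.
move=> st; have [s0|s0] := ltP s 0.
  by have := @g_product_neg (- s) t; rewrite opprK; apply; slra.
have [t0|t0] := ltP t 0.
  by have := @g_product_neg (- t) s; rewrite opprK [g t * _]mulrC; apply; slra.
have c0 : 0 <= c by have := bB_small; slra.
have as0 : 0 <= a * s by rewrite mulr_ge0// ltW.
have at0 : 0 <= a * t by rewrite mulr_ge0// ltW.
apply: (@le_trans _ _ ((c + a * s) * (c + a * t))); last first.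
  have := bphi_ge0 s; have := bphi_ge0 t; rewrite !gE => h1 h2.
  by apply: ler_pM; slra.
have := mulr_ge0 as0 at0 => h1.
have qk0 : 0 <= (k - k') * q by rewrite mulr_ge0 ?(ltW q_gt0)//; slra.
have : c * (2 * w) <= c * (a * (s + t)).
  by rewrite ler_wpM2l// mulrCA ler_wpM2l// ltW.
have := T_base; slra.
Qed.

Lemma tilted_multiplier_separates : exists lam psi,
  admissible phi B lam /\ separates phi B Delta lam (k' * q) psi.
Proof.
have adm : admissible phi B (a, b).
  split=> [|x]; first exact: ltW.
  split; first exact: g_gt0.
  by have := g_gt0 (- x); rewrite /g_u /g_l phi_even mulrN.
have [|psi] := @exists_separates R phi B phi_even Delta (k' * q) (a, b) adm.
  move=> s t /g_product; apply: le_trans; rewrite mulrA.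
  by apply: expR_le_1Dx => //; exact: ltW.
by exists (a, b), psi.
Qed.

End tilted_multiplier.

(** * Tilted multipliers for large [X] *)

(** The bound e >= c0 / w gives e^2 X >= c0^2 w^2. Thus q / e^2 is at most B / (c0^2 L), small
    because [L] is large, while (A x1)^2 / q is of order L / (e^2 X) <= C / (c0^2 w), small because
    [w] is large. *)
Lemma tilt_parameters_small (R : realType) (k k' B x1 c0 C w L e X : R) :
    0 <= k' -> k' < k -> k < 1 -> 0 < B -> 1 <= x1 -> 0 < c0 -> 0 < C ->
    0 < L -> 0 < e -> e <= 1 -> X = w ^+ 4 -> c0 <= e * w -> L <= C * w ->
    B <= L -> 16 * B / (c0 ^+ 2 * (k - k')) <= L ->
    4 * B / (c0 ^+ 2 * (1 - k)) <= L ->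
    1 <= w -> 8 * x1 / c0 <= w ->
    24 * x1 ^+ 2 * C / (c0 ^+ 2 * ((k - k') * B)) <= w ->
  let q := B / (X * L) in
  let A := k * (1 + e) / (e * X) in
  [/\ q <= (k - k') / 4, q / e <= (1 - k) / 4, q / e ^+ 2 <= (k - k') / 16,
      A * x1 <= 1 / 4 &
      (A * x1) ^+ 2 + 2 * (A * x1) * (A * (B / L)) <= (k - k') / 2 * q].
Proof.
move=> k'0 k'k k1 B0 x1_ge1 c00 C0 L0 e0 e_le1 Xw ew LC LB L16 L4 w1 w8 w24.
have kk0 : 0 < k - k' by rewrite subr_gt0.
have k10 : 0 < 1 - k by rewrite subr_gt0.
have k0 : 0 < k by exact: le_lt_trans k'k.
have w0 : 0 < w by exact: lt_le_trans w1.
have X0 : 0 < X by rewrite Xw exprn_gt0.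
have x10 : 0 < x1 by exact: lt_le_trans x1_ge1.
have ne : [/\ e != 0, X != 0, L != 0, c0 != 0 & w != 0].
  by split; rewrite gt_eqF.
have {ne}[ne nX nL nc nw] := ne.
have e2X : c0 ^+ 2 * w ^+ 2 <= e ^+ 2 * X.
  have -> : e ^+ 2 * X = (e * w) ^+ 2 * w ^+ 2 by rewrite Xw; ring.
  by rewrite ler_wpM2r ?sqr_ge0// lerXn2r ?nnegrE// ltW// mulr_gt0.
have e2X1 : c0 ^+ 2 <= e ^+ 2 * X.
  by apply: le_trans e2X; rewrite ler_peMr ?sqr_ge0// expr_ge1// ltW.
have q0 : 0 < B / (X * L) by rewrite divr_gt0 ?mulr_gt0.
have qe2 : B / (X * L) / e ^+ 2 <= B / (c0 ^+ 2 * L).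
  have -> : B / (X * L) / e ^+ 2 = B / (e ^+ 2 * X * L).
    by field; rewrite ne nX nL.
  by rewrite ler_pM2l// lef_pV2 ?posrE ?mulr_gt0 ?exprn_gt0// ler_pM2r.
have qe2k : B / (X * L) / e ^+ 2 <= (k - k') / 16.
  apply: le_trans qe2 _; move: L16; rewrite !ler_pdivrMr ?mulr_gt0 ?exprn_gt0//.
  by clear; lra.
have qe2k1 : B / (X * L) / e ^+ 2 <= (1 - k) / 4.
  apply: le_trans qe2 _; move: L4; rewrite !ler_pdivrMr ?mulr_gt0 ?exprn_gt0//.
  by clear; lra.
have qe : B / (X * L) / e <= B / (X * L) / e ^+ 2.
  by rewrite ler_pM2l// lef_pV2 ?posrE ?exprn_gt0// expr2 ger_pMr.
have qq : B / (X * L) <= B / (X * L) / e by rewrite ler_pdivlMr// ger_pMr.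
set A := k * (1 + e) / (e * X).
have A0 : 0 < A by rewrite divr_gt0 ?mulr_gt0// addr_gt0.
have A2 : A <= 2 / (e * X).
  rewrite ler_pM2r ?invr_gt0 ?mulr_gt0//.
  have : k * (1 + e) <= 1 * 2 by apply: ler_pM => //; [exact: ltW|move: e0; clear; lra|exact: ltW|move: e_le1; clear; lra].
  by clear; lra.
have D1 : B / L <= 1 by rewrite ler_pdivrMr// mul1r.
split.
- by apply: le_trans qq (le_trans qe (le_trans qe2k _)); clear -kk0; lra.
- exact: le_trans qe2k1.
- exact: qe2k.
- apply: (@le_trans _ _ (2 / (e * X) * x1)); first by rewrite ler_pM2r.
  rewrite mulrAC ler_pdivrMr ?mulr_gt0//.
  move: w8; rewrite ler_pdivrMr// => w8.
  have : w * c0 <= e * X; last by move: w8; clear; lra.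
  apply: (@le_trans _ _ ((e * w) * w)); first by rewrite mulrC ler_pM2r.
  rewrite -mulrA ler_pM2l// Xw -expr2.
  by rewrite ler_weXn2l.
- have Ax0 : 0 < A * x1 by rewrite mulr_gt0.
  have hA : (A * x1) ^+ 2 <= (2 / (e * X) * x1) ^+ 2.
    apply: lerXn2r; rewrite ?nnegrE; [exact: ltW| |by rewrite ler_pM2r].
    by apply: ltW; rewrite mulr_gt0// divr_gt0 ?mulr_gt0.
  apply: (@le_trans _ _ (3 * (2 / (e * X) * x1) ^+ 2)).
    have : A * (B / L) <= A * x1 by rewrite (ler_pM2l A0); exact: le_trans D1 x1_ge1.
    by move/(ler_wpM2l (ltW Ax0)); move: hA; clear; lra.
  have -> : 3 * (2 / (e * X) * x1) ^+ 2 = (12 * x1 ^+ 2 * L / (e ^+ 2 * X)) / (X * L).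
    by field; rewrite ne nX nL.
  rewrite mulrA ler_pM2r ?invr_gt0 ?mulr_gt0//.
  have x12 : 0 < x1 ^+ 2 by rewrite exprn_gt0.
  apply: (@le_trans _ _ (12 * x1 ^+ 2 * (C * w) / (c0 ^+ 2 * w ^+ 2))).
    apply: ler_pM.
    + by rewrite ltW// !mulr_gt0.
    + by rewrite ltW// invr_gt0 mulr_gt0// exprn_gt0.
    + by rewrite ler_pM2l// mulr_gt0.
    + by rewrite lef_pV2 ?posrE ?mulr_gt0 ?exprn_gt0.
  have -> : 12 * x1 ^+ 2 * (C * w) / (c0 ^+ 2 * w ^+ 2) =
      12 * x1 ^+ 2 * C / (c0 ^+ 2 * w) by field; rewrite nc nw.
  move: w24; rewrite !ler_pdivrMr ?mulr_gt0 ?exprn_gt0//.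
  by clear; lra.
Qed.

(** Here [l] will be [Lam x], below [(1 - d) * L], and the Potter bound yields d rho <= 4 e.
    Bounding 1 + e by 2 and clearing common factors leaves 12 k rho^4 L / e <= l, which follows from
    12 rho^3 <= e and L rho <= l. *)
Lemma tilt_dichotomy_left (R : realType) (k d L l e X x rho : R) :
    0 < k -> k < 1 -> 0 < d -> 0 < L -> 0 < e -> e <= 1 -> 0 < X -> 0 < x ->
    0 < rho -> e <= (d / 10) ^+ 3 -> d * rho <= 4 * e -> L * rho <= l ->
    x = X * rho ^+ 4 ->
  3 * (k * (1 + e) / (e * X) * x) ^+ 2 <= k / (e * X * L) * (x * l).
Proof.
move=> k0 k1 d0 L0 e0 e1 X0 x0 rho0 e_le d_rho rhoL xE.
have ne : [/\ e != 0, X != 0, L != 0 & x != 0] by split; rewrite gt_eqF.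
have {ne}[ne nX nL nx] := ne.
(* From rho <= 4 e / d and e^3 <= (d / 10)^3 e, rho^3 is at most 64 e / 1000, and 12 * 64 < 1000. *)
have rho3 : 12 * rho ^+ 3 <= e.
  have h1 : (d * rho) ^+ 3 <= (4 * e) ^+ 3.
    by apply: lerXn2r; rewrite ?nnegrE// ltW// mulr_gt0.
  have h2 : e ^+ 2 * e <= (d / 10) ^+ 3 * e.
    by rewrite ler_pM2r//; apply: le_trans e_le; rewrite expr2 ger_pMr.
  have d3 : 0 < d ^+ 3 * e by rewrite mulr_gt0 ?exprn_gt0.
  rewrite -(@ler_pM2l _ (d ^+ 3)) ?exprn_gt0//.
  by move: h1 h2 d3; clear; lra.
apply: (@le_trans _ _ (3 * (2 * k / (e * X) * x) ^+ 2)).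
  rewrite ler_pM2l// lerXn2r ?nnegrE//.
  - by rewrite ltW// mulr_gt0// divr_gt0 ?mulr_gt0 ?addr_gt0.
  - by rewrite ltW// mulr_gt0// divr_gt0 ?mulr_gt0.
  rewrite ler_pM2r// ler_pM2r ?invr_gt0 ?mulr_gt0// mulrC ler_pM2r//.
  by move: e1; clear; lra.
have -> : 3 * (2 * k / (e * X) * x) ^+ 2 =
    k / (e * X * L) * (x * (12 * k * (x / X) / e * L)).
  by field; rewrite ne nX nL.
rewrite ler_pM2l ?divr_gt0 ?mulr_gt0// ler_pM2l//.
apply: le_trans rhoL; rewrite [leRHS]mulrC ler_pM2r// ler_pdivrMr//.
have -> : x / X = rho ^+ 4 by rewrite xE mulrC mulKf.
apply: (@le_trans _ _ (12 * 1 * rho ^+ 4)).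
  by rewrite ler_pM2r ?exprn_gt0// ler_pM2l// ltW.
by have := ler_wpM2l (ltW rho0) rho3; clear; lra.
Qed.

Section asymptotics.
Context (R : realType) (phi : R -> R) (B xinf Lambda0 : R) (eta deta : R -> R).
Hypothesis hphi : slowly_varying_moment_class phi B xinf Lambda0 eta deta.

Local Notation Lam := (Lam xinf Lambda0 eta).

Lemma B_gt0 : 0 < B.
Proof. exact: le_lt_trans (svm_ge0 hphi 0) (svm_lt_B hphi). Qed.

Lemma phi_nd x y : 0 <= x -> x <= y -> phi x <= phi y.
Proof.
move=> x0 xy; apply: (svm_nondecreasing hphi); rewrite // in_itv/= andbT//.
exact: le_trans xy.
Qed.

Lemma Lam_ge_eventually K : exists M, forall x, M <= x -> K <= Lam x.
Proof.
have [M [_ MP]] := (cvgryPge _).1 (svm_superlinear_pinfty hphi) K.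
exists (Num.max (M + 1) xinf) => x; rewrite ge_max => /andP[Mx xx].
rewrite -(Lambda_Lam hphi)//; apply: MP; apply: lt_le_trans Mx.
by rewrite ltrDl.
Qed.

Lemma quartic_root_ge (K x : R) : K ^+ 4 <= x -> 0 < x -> K <= quartic_root x.
Proof.
move=> Kx x0; rewrite leNgt; apply/negP => xK; move: Kx; apply/negP.
rewrite -ltNge -{1}(quartic_rootX4 x0) ltrXn2r ?nnegrE ?ltW ?quartic_root_gt0//.
Qed.

Lemma eta_small_eventually (eps : R) : 0 < eps -> exists M, [/\ xinf <= M,
  forall x, M < x -> eta x <= eps &
  forall x, M < x -> `|x * deta x / eta x| <= 4^-1].
Proof.
move=> eps0.
have [M1 [_ M1P]] := cvgr0_norm_le _ (svm_eta_cvg0 hphi) _ eps0.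
have q0 : (0 : R) < 4^-1 by [].
have [M2 [_ M2P]] := cvgr0_norm_le _ (svm_eta_slow hphi) _ q0.
exists (Num.max xinf (Num.max M1 M2)); split; first by rewrite le_max lexx.
  move=> x; rewrite !gt_max => /and3P[_ /M1P h _].
  exact: le_trans (ler_norm _) h.
by move=> x; rewrite !gt_max => /and3P[_ _ /M2P].
Qed.

(** [k] is midway between [k'] and 1, leaving room on both sides. The constants [d], [a], [x1], [c0]
    and [C] are fixed before [X], so every smallness condition holds once [X] is large. *)
Lemma eventually_separates (k' : R) : 0 <= k' -> k' < 1 ->
  exists M, forall X, M <= X -> exists lam psi,
    admissible phi B lam /\
    separates phi B (B / Lam X) lam (k' * (B / (X * Lam X))) psi.
Proof.
move=> k'0 k'1; pose k := (1 + k') / 2; pose d := (1 - k) / 64.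
have k'k : k' < k by rewrite /k; lra.
have k1 : k < 1 by rewrite /k; lra.
have d0 : 0 < d by rewrite /d; lra.
have d1 : d <= 1 / 64 by rewrite /d; lra.
have dk : d <= (1 - k) / 64 by [].
clearbody d; clearbody k.
have eps0 : 0 < (d / 10) ^+ 3 by rewrite exprn_gt0// divr_gt0.
have eps_le : (d / 10) ^+ 3 <= d.
  have : d ^+ 3 <= d by rewrite exprS ger_pMr// expr_le1// ?ltW//; lra.
  by move: d0; lra.
have [a [xa eta_le eta_slow]] := eta_small_eventually eps0.
have eta_le4 x : a < x -> eta x <= 4^-1.
  by move=> /eta_le; move: eps_le d1; lra.
have a1 : 1 < a by exact: lt_le_trans (svm_xinf_gt1 hphi) xa.
have [x1 ax1] : exists x1, a < x1 by exists (a + 1); rewrite ltrDl.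
have x1_ge1 : 1 <= x1 by rewrite ltW// (lt_trans a1).
have eta_pos x : a < x -> 0 < eta x.
  by move=> ax; rewrite (svm_eta_gt0 hphi)// (le_trans xa)// ltW.
have [c0 c0E] : exists c0, c0 = eta x1 * quartic_root x1 by eexists.
have c00 : 0 < c0 by rewrite c0E mulr_gt0 ?quartic_root_gt0 ?eta_pos.
have [C CE] : exists C, C = Lam x1 / quartic_root x1 by eexists.
have C0 : 0 < C by rewrite CE divr_gt0 ?quartic_root_gt0// (Lam_gt0 hphi).
have [M0 M0P] := Lam_ge_eventually (Num.max B
  (Num.max (16 * B / (c0 ^+ 2 * (k - k'))) (4 * B / (c0 ^+ 2 * (1 - k))))).
exists (Num.max x1 (Num.max M0 ((Num.max 1 (Num.max (8 * x1 / c0)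
  (24 * x1 ^+ 2 * C / (c0 ^+ 2 * ((k - k') * B))))) ^+ 4))) => X.
rewrite !ge_max => /and3P[x1X /M0P L_ge KX].
have aX := lt_le_trans ax1 x1X; have X0 : 0 < X by exact: lt_trans (lt_trans ltr01 a1) aX.
have {KX} := quartic_root_ge KX X0.
move: L_ge; rewrite !ge_max => /and3P[LB L16 L4] /and3P[w1 w8 w24].
have Xw : X = quartic_root X ^+ 4 by rewrite quartic_rootX4.
have e_le : eta X <= (d / 10) ^+ 3 by exact: eta_le.
have ed : eta X <= d by exact: le_trans eps_le.
have e1 : eta X <= 1 by move: ed d1; lra.
have ew : c0 <= eta X * quartic_root X.
  by rewrite c0E; exact: (eta_quartic_root_nd hphi xa eta_slow ax1 x1X).
have LC : Lam X <= C * quartic_root X.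
  rewrite -ler_pdivrMr ?quartic_root_gt0// CE.
  exact: (Lam_quartic_root_ni hphi xa eta_le4 ax1 x1X).
have LX0 := Lam_gt0 hphi X.
have [q4 qe qe2 Ax1 a_small] := tilt_parameters_small k'0 k'k k1 B_gt0 x1_ge1
  c00 C0 LX0 (eta_pos X aX) e1 Xw ew LC LB L16 L4 w1 w8 w24.
apply: (tilted_multiplier_separates (svm_ge0 hphi) (svm_even hphi) phi_nd
  B_gt0 k'0 k'k k1 d0 dk x1_ge1 X0 LX0 (eta_pos X aX) ed
  (erefl _) (erefl _) (erefl _) (erefl _) q4 qe qe2 Ax1 _ a_small).
- by rewrite ler_pdivrMr ?mul1r.
- move=> x xx1; rewrite -(phiE hphi); last by rewrite (le_trans xa)// ltW.
  exact: (phi_ge_tangent hphi xa eta_slow (lt_trans ax1 xx1) aX).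
move=> x xx1; have ax := lt_trans ax1 xx1.
have x0 : 0 < x by exact: lt_trans (lt_trans ltr01 a1) ax.
rewrite (phiE hphi); last by rewrite (le_trans xa)// ltW.
have [Lx|Lx] := leP ((1 - d) * Lam X) (Lam x).
  by right; rewrite [Lam X * x]mulrC mulrCA ler_pM2l.
left; have xX : x <= X.
  rewrite leNgt; apply/negP => Xx; move: Lx; apply/negP; rewrite -leNgt.
  apply: le_trans (Lam_nd hphi (le_lt_trans xa aX) (ltW Xx)).
  by rewrite ger_pMl// gerBl ltW.
apply: (@tilt_dichotomy_left _ k d _ _ _ _ _ (quartic_root x / quartic_root X)) => //.
- exact: le_lt_trans k'k.
- exact: eta_pos.
- by rewrite divr_gt0 ?quartic_root_gt0.
(* Since (1 - d) exp(d) <= 1, a relative gap [d] between values of [Lam] is a gap of at least [d]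
   between their logarithms. *)
- have dF : d <= log_Lambda xinf eta X - log_Lambda xinf eta x.
    rewrite -ler_expR expRB ler_pdivlMr ?expR_gt0//.
    have hd : (1 - d) * expR d <= 1.
      by rewrite -ler_pdivlMr ?expR_gt0// mul1r -expRN; exact: expR_ge1Dx.
    move: Lx; rewrite Lam.unlock mulrCA ltr_pM2l ?(svm_Lambda0_gt0 hphi)// => Lx.
    apply: (@le_trans _ _ (expR d * ((1 - d) * expR (log_Lambda xinf eta X)))).
      by rewrite ler_pM2l ?expR_gt0// ltW.
    by rewrite mulrA ger_pMl ?expR_gt0// mulrC.
  have := le_trans dF (log_Lambda_potter hphi xa eta_slow ax xX).
  by rewrite ler_pdivlMr ?quartic_root_gt0// mulrA ler_pdivrMr ?quartic_root_gt0.
- have := Lam_quartic_root_ni hphi xa eta_le4 ax xX.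
  by rewrite ler_pdivlMr ?quartic_root_gt0// -mulrA [_^-1 * _]mulrC.
- rewrite expr_div_n !quartic_rootX4// mulrC divfK// gt_eqF//.
Qed.

End asymptotics.

(** * Inverting the margin function *)

Lemma pinv_spec (T : pointedType) (U : Type) (A : set T) (f : T -> U) (y : U) :
  (f @` A) y -> A (pinv A f y) /\ f (pinv A f y) = y.
Proof.
move=> Ay; split; last by rewrite pinvK// inE.
have fA : set_surj A (f @` A) f by [].
by apply: (surjpinv_image_sub fA); exists y.
Qed.

Section margin_inverse.
Context (R : realType) (phi : R -> R) (B xinf Lambda0 : R) (eta deta : R -> R).
Hypothesis hphi : slowly_varying_moment_class phi B xinf Lambda0 eta deta.

Local Notation Lam := (Lam xinf Lambda0 eta).

Let xinf_gt0 : 0 < xinf. Proof. exact: lt_trans (svm_xinf_gt1 hphi). Qed.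

Lemma log_Lambda_incr x y : xinf < x -> x < y ->
  log_Lambda xinf eta x < log_Lambda xinf eta y.
Proof.
move=> xx xy.
have [z|c|c cxy /eqP] := @MVT R (log_Lambda xinf eta) (fun u => eta u / u) x y xy.
- by rewrite in_itv/= => /andP[xz _]; apply/(is_derive_log_Lambda hphi)/(lt_trans xx).
- apply: derivable_within_continuous => w; rewrite in_itv/= => /andP[xw _].
  by have [] := is_derive_log_Lambda hphi (lt_le_trans xx xw).
have xc : xinf < c by move: cxy; rewrite in_itv/= => /andP[/(lt_trans xx)].
rewrite subr_eq => /eqP ->; rewrite ltrDr mulr_gt0 ?subr_gt0// divr_gt0//.
  exact/(svm_eta_gt0 hphi)/ltW.
exact: lt_trans xc.
Qed.

Lemma Lam_inj x y : xinf < x -> xinf < y -> Lam x = Lam y -> x = y.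
Proof.
move=> xx xy; rewrite !(LamE hphi) => /expR_inj/addrI E.
apply/eqP; rewrite eq_le !leNgt; apply/andP; split; apply/negP.
  by move=> /(log_Lambda_incr xy); rewrite E ltxx.
by move=> /(log_Lambda_incr xx); rewrite E ltxx.
Qed.

Lemma Lam_IVT (x v : R) : xinf <= x -> Lam x <= v -> exists2 y, x <= y & Lam y = v.
Proof.
move=> xx xv; have [M MP] := Lam_ge_eventually hphi v.
set z := Num.max x M.
have xz : x <= z by rewrite le_max lexx.
have vz : v <= Lam z by apply: MP; rewrite le_max lexx orbT.
have [|||c] := @IVT _ (Lambda phi) x z v.
- exact: xz.
- apply: continuous_in_subspaceT => y; rewrite inE/= in_itv/= => /andP[xy _].
  apply: cvgM; first exact: (svm_continuous hphi).
  have y0 : 0 < y by exact: lt_le_trans (le_trans xx xy).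
  apply: cvgV; first by rewrite normr_eq0 gt_eqF.
  exact: norm_continuous.
- by rewrite !(Lambda_Lam hphi) ?(le_trans xx xz)// ge_min xv le_max vz orbT.
rewrite in_itv/= => /andP[xc _] <-; exists c => //.
by rewrite (Lambda_Lam hphi)// (le_trans xx).
Qed.

Lemma phi_IVT (x v : R) : xinf < x -> phi x <= v -> exists2 y, x <= y & phi y = v.
Proof.
move=> xx xv; have [M MP] := Lam_ge_eventually hphi `|v|.
set z := Num.max x M.
have xz : x <= z by rewrite le_max lexx.
have vz : v <= phi z.
  rewrite (phiE hphi); last by rewrite (le_trans (ltW xx)).
  apply: le_trans (ler_norm _) _.
  have h : `|v| <= Lam z by apply: MP; rewrite le_max lexx orbT.
  apply: le_trans h _; rewrite ler_peMl ?(ltW (Lam_gt0 hphi _))//.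
  by rewrite ltW// (lt_le_trans _ xz)// (lt_trans (svm_xinf_gt1 hphi)).
have [|||c] := @IVT _ phi x z v.
- exact: xz.
- by apply: continuous_subspaceT; exact: svm_continuous hphi.
- by rewrite ge_min xv le_max vz orbT.
by rewrite in_itv/= => /andP[xc _] <-; exists c.
Qed.

(** With Delta = B / Lam(X), [margin_fun] becomes B / phi(X), so inverting it at [xi] means solving
    phi(X) = B / xi. *)
Lemma margin_inv_spec (M : R) : exists2 xi0, 0 < xi0 & forall xi, 0 < xi -> xi < xi0 ->
  exists X, [/\ M <= X, xinf < X, margin_inv phi B xinf xi = B / Lam X &
    xi = B / (X * Lam X)].
Proof.
have B0 := B_gt0 hphi.
have BK l : B / (B / l) = l by rewrite invf_div mulrCA divff ?mulr1 ?gt_eqF.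
(* The added 1 makes [Lam Y] strictly larger than [Lam xinf], so that [Lambda_inv] cannot return the
   endpoint [xinf], which [Lam_inj] excludes. *)
have [M0 M0P] := Lam_ge_eventually hphi (Lam xinf + 1).
set m := Num.max (Num.max M M0) (xinf + 1).
have xm : xinf < m by rewrite lt_max ltrDl ltr01 orbT.
have Mm : M <= m by rewrite !le_max lexx.
have M0m : M0 <= m by rewrite !le_max lexx orbT.
have phim : 0 < phi m.
  rewrite (phiE hphi) ?mulr_gt0 ?(Lam_gt0 hphi)//; last exact: ltW.
  exact: lt_trans xm.
exists (B / phi m); first by rewrite divr_gt0.
move=> xi xi0 xi_lt.
have [|Y mY phiY] := @phi_IVT m (B / xi) xm.
  by rewrite ler_pdivlMr// mulrC -ler_pdivlMr// ltW.
have xY : xinf < Y by exact: lt_le_trans mY.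
have LY := Lam_gt0 hphi Y.
have Y0 : 0 < Y by exact: lt_trans xY.
have xiE : xi = B / (Y * Lam Y).
  by rewrite -(phiE hphi) ?(ltW xY)// phiY invf_div mulrC divfK ?gt_eqF.
have LxY : Lam xinf < Lam Y.
  by apply: lt_le_trans (M0P _ (le_trans M0m mY)); rewrite ltrDl.
have LinvP (Z : R) : xinf <= Z ->
    xinf <= Lambda_inv phi xinf (Lam Z) /\ Lam (Lambda_inv phi xinf (Lam Z)) = Lam Z.
  move=> xZ; have [|] := @pinv_spec R R `[xinf, +oo[%classic (Lambda phi) (Lam Z).
    by exists Z; [rewrite /= in_itv/= xZ|rewrite (Lambda_Lam hphi)].
  rewrite -/(Lambda_inv phi xinf (Lam Z)) /= in_itv/= andbT => xW.
  by rewrite (Lambda_Lam hphi).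
have LinvK (Z : R) : xinf < Z -> Lam xinf < Lam Z -> Lambda_inv phi xinf (Lam Z) = Z.
  move=> xZ LZ.
  have [] := LinvP Z (ltW xZ) => xW LW.
  apply: Lam_inj => //; rewrite lt_neqAle xW andbT; apply/eqP => xWE.
  by move: LZ; rewrite -LW -xWE ltxx.
(* [Y] shows that [xi] is in the image of [margin_fun], so [margin_inv] is a true preimage; the
   point sought is then read off from that preimage as [W]. *)
have [|] := @pinv_spec R R (margin_dom phi B xinf) (margin_fun phi B xinf) xi.
  exists (B / Lam Y); rewrite /margin_dom /margin_fun /=.
    split; first exact: divr_gt0.
    by rewrite BK (Lambda_Lam hphi)// ltW.
  rewrite BK LinvK// xiE.
  by rewrite invfM mulrA mulrAC.
rewrite -/(margin_inv phi B xinf xi); set D := margin_inv _ _ _ _.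
move=> [D0]; rewrite (Lambda_Lam hphi)// => LD.
have [V xV LV] := Lam_IVT (lexx _) LD.
have [xW LW] := LinvP V xV; rewrite /margin_fun -LV.
move: xW LW; set W := Lambda_inv _ _ _ => xW LW DW.
have W0 : 0 < W by exact: lt_le_trans xW.
have LW0 := Lam_gt0 hphi W.
have DE : D = B / Lam W by rewrite LW LV BK.
have xiW : xi = B / (W * Lam W) by rewrite -DW DE invfM mulrA mulrAC.
have mW : m < W.
  rewrite ltNge; apply/negP => Wm; move: xi_lt; rewrite xiW -(phiE hphi)//.
  rewrite ltr_pM2l// ltf_pV2 ?posrE//.
    by rewrite ltNge (phi_nd hphi (ltW W0) Wm).
  by rewrite (phiE hphi)// mulr_gt0.
exists W; split => //; first exact: le_trans (ltW mW).
exact: lt_trans mW.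
Qed.

End margin_inverse.

(** * Level at the inflated margin *)

Section inflated_margin.
Context (R : realType) (phi : R -> R) (B xinf Lambda0 : R) (eta deta : R -> R).
Hypothesis hphi : slowly_varying_moment_class phi B xinf Lambda0 eta deta.

(** The slack of any explicit multipliers is a lower bound for the optimal rate, hence controls the
    level of every optimal score. *)
Lemma optimal_score_level_le (beta Delta r : R) n psi :
    optimal_score phi B Delta psi ->
    (exists lam psi, admissible phi B lam /\ separates phi B Delta lam r psi) ->
    expR (- r) ^+ n <= beta ->
  (worst_case_level phi B (@M_estimator R psi n) Delta <= beta%:E)%E.
Proof.
move=> [lam [r' [adm optE sep]]] ex_r r_beta.
apply: le_trans (worst_case_level_M_estimator_le (sep.1) n (svm_ge0 hphi)
  (svm_continuous hphi) adm sep) _.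
rewrite lee_fin; apply: le_trans r_beta.
rewrite lerXn2r ?nnegrE ?expR_ge0// ler_expR lerN2 -lee_fin -optE.
by apply: ereal_sup_ubound; exists r.
Qed.

(** Write the margin as B / Lam(Y) and the inflated one as B / Lam(X), so that Lam(X) = Lam(Y) / (1
    + eps) and X <= Y. With k' = 1 / (1 + eps), the rate k' B / (X Lam(X)) equals B / (X Lam(Y)), at
    least B / (Y Lam(Y)) = xi. *)
Lemma inflated_margin_rate (eps : R) : 0 < eps ->
  exists2 xi0, 0 < xi0 & forall xi, 0 < xi -> xi < xi0 ->
    0 < margin_inv phi B xinf xi /\
    exists2 r, xi <= r & exists lam psi, admissible phi B lam /\
      separates phi B (margin_inv phi B xinf xi * (1 + eps)) lam r psi.
Proof.
move=> eps0; have eps1 : 0 < 1 + eps by rewrite addr_gt0.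
have B0 := B_gt0 hphi; have L0 := Lam_gt0 hphi.
have k0 : 0 <= (1 + eps)^-1 by rewrite invr_ge0 ltW.
have k1 : (1 + eps)^-1 < 1 by rewrite invf_lt1// ltrDl.
have [M MP] := eventually_separates hphi k0 k1.
set m := Num.max M (xinf + 1).
have xm : xinf < m by rewrite lt_max ltrDl ltr01 orbT.
(* Beyond [M1], [Lam Y / (1 + eps)] is at least [Lam m], so [X] can be taken beyond [m]. *)
have [M1 M1P] := Lam_ge_eventually hphi (Lam xinf Lambda0 eta m * (1 + eps)).
have [xi0 xi00 xi0P] := margin_inv_spec hphi (Num.max m M1).
exists xi0 => // xi xi_gt0 /(xi0P _ xi_gt0)[Y []].
rewrite ge_max => /andP[mY /M1P LmY] xY -> xiE.
have Y0 : 0 < Y by rewrite (lt_trans _ xY)// (lt_trans _ (svm_xinf_gt1 hphi)).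
split; first exact: divr_gt0.
have [|X mX LX] := @Lam_IVT _ _ _ _ _ _ _ hphi m
    (Lam xinf Lambda0 eta Y / (1 + eps)) (ltW xm).
  by rewrite ler_pdivlMr.
have xX : xinf < X by exact: lt_le_trans mX.
have X0 : 0 < X by rewrite (lt_trans _ xX)// (lt_trans _ (svm_xinf_gt1 hphi)).
have XY : X <= Y.
  rewrite leNgt; apply/negP => YX.
  have := Lam_nd hphi xY (ltW YX); rewrite LX leNgt => /negP; apply.
  by rewrite ltr_pdivrMr// ltr_pMr// ltrDl.
have [|lam [psi [adm sep]]] := MP X; first by rewrite (le_trans _ mX)// le_max lexx.
exists ((1 + eps)^-1 * (B / (X * Lam xinf Lambda0 eta X))).
  rewrite xiE LX [leRHS](_ : _ = B / (X * Lam xinf Lambda0 eta Y)).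
    by rewrite ler_pM2l// lef_pV2 ?posrE ?mulr_gt0// ler_pM2r.
  by field; rewrite !gt_eqF.
exists lam, psi; split => //.
by rewrite (_ : B / _ * _ = B / Lam xinf Lambda0 eta X)// LX invf_div mulrA mulrAC.
Qed.

Lemma inflated_margin_level (beta eps : R) : 0 < beta < 1 -> 0 < eps ->
  \forall n \near \oo,
    let D := margin_inv phi B xinf (ln (1 / beta) / n%:R) in
    0 < D /\ forall psi, optimal_score phi B (D * (1 + eps)) psi ->
      (worst_case_level phi B (@M_estimator R psi n) (D * (1 + eps)) <= beta%:E)%E.
Proof.
move=> /andP[b0 b1] /inflated_margin_rate[xi0 xi00 xi0P].
have l0 : 0 < ln (1 / beta) by rewrite ln_gt0// div1r invf_gt1.
near=> n.
have n0 : 0 < n%:R :> R by rewrite ltr0n; near: n; exact: nbhs_infty_gt.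
have [||D0 [r xir sep]] := xi0P (ln (1 / beta) / n%:R).
- exact: divr_gt0.
- rewrite ltr_pdivrMr// [xi0 * _]mulrC -ltr_pdivrMr//.
  by near: n; exact: nbhs_infty_gtr.
split => // psi opt; apply: optimal_score_level_le opt sep _.
rewrite -expRM_natl -[leRHS]lnK ?posrE// ler_expR.
move: xir; rewrite ler_pdivrMr// div1r lnV ?posrE// => xir.
by rewrite mulrN lerNl [_ * r]mulrC.
Unshelve. all: by end_near. Qed.

End inflated_margin.

(* Diagonal extraction: choosing, at each index, a nearly smallest admissible
   relative error makes the relative errors vanish. *)
Lemma vanishing_choice (R : realType) (G : nat -> set R) :
    (forall eps, 0 < eps -> \forall n \near \oo, G n eps) ->
  exists2 eps : nat -> R, eps n @[n --> \oo] --> 0 &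
    \forall n \near \oo, 0 < eps n /\ G n (eps n).
Proof.
move=> GP; pose H n := [set e | 0 < e /\ G n e].
have H_lb n : has_lbound (H n) by exists 0 => e [/ltW].
have ex_eps n : exists e, (exists e', H n e') ->
    H n e /\ forall e', H n e' -> e <= e' + n.+1%:R^-1.
  (* The default 0 occurs at finitely many indices at most, as [H n] eventually contains 1. *)
  have [[e' He']|nH] := pselect (exists e', H n e'); last by exists 0 => /nH.
  have n0 : 0 < n.+1%:R^-1 :> R by rewrite invr_gt0 ltr0n.
  have [|e He e_lt] := inf_adherent n0 (_ : has_inf (H n)); first by split; [exists e'|].
  exists e => _; split => // e'' /(ge_inf (H_lb n)) h.
  by apply: le_trans (ltW e_lt) _; rewrite lerD2r.
have [eps epsP] := choice ex_eps; exists eps.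
  apply/cvgr0Pnorm_le => d d0; have d20 : 0 < d / 2 by rewrite divr_gt0.
  near=> n; have Gn : H n (d / 2) by split => //; near: n; exact: GP.
  have [|[e0 _] e_le] := epsP n; first by exists (d / 2).
  rewrite gtr0_norm//; apply: le_trans (e_le _ Gn) _.
  have : n.+1%:R^-1 < d / 2 by near: n; exact: (near_infty_natSinv_lt (PosNum d20)).
  by move=> /ltW h; rewrite [leRHS]splitr lerD2l.
near=> n; have Gn : G n 1 by near: n; apply: GP.
by have [] := epsP n; first by exists 1.
Unshelve. all: by end_near. Qed.

Theorem corollary5 (R : realType) (phi : R -> R) (B xinf Lambda0 : R)
    (eta deta : R -> R)
    (hphi : slowly_varying_moment_class phi B xinf Lambda0 eta deta)
    (beta : R) (hbeta : 0 < beta < 1) :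
  exists Delta : nat -> R,
    [/\ forall n, 0 < Delta n,
        exists2 eps : nat -> R, eps n @[n --> \oo] --> 0 &
          \forall n \near \oo,
            Delta n = margin_inv phi B xinf (ln (1 / beta) / n%:R) * (1 + eps n)
      & \forall n \near \oo, forall psi : R -> R,
          optimal_score phi B (Delta n) psi ->
          (worst_case_level phi B (@M_estimator R psi n) (Delta n) <= beta%:E)%E].
Proof.
have [eps eps0 epsP] := vanishing_choice (fun e e0 =>
  inflated_margin_level hphi hbeta e0).
pose D n := margin_inv phi B xinf (ln (1 / beta) / n%:R).
(* The value 1 keeps the margin positive at the finitely many indices where the intended one is
   not. *)
pose Delta n := if 0 < D n * (1 + eps n) then D n * (1 + eps n) else 1.
have DeltaE : \forall n \near \oo, Delta n = D n * (1 + eps n).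
  apply: filterS epsP => n [e0 [D0 _]].
  by rewrite /Delta ifT// mulr_gt0// addr_gt0.
exists Delta; split.
- by move=> n; rewrite /Delta; case: ifP.
- by exists eps.
- by apply: filterS2 DeltaE epsP => n -> [_ [_]].
Qed.
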